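(* Let $X$ and $Y$ be Banach spaces, and let $\eta : X \to Y$ be a continuous linear map. Let $\mathbb{P}$ be a Gaussian (Radon) probability measure on $X$ with mean zero and covariance operator $K : X^* \to X$. Suppose that $$M = \sup_{e \in Y^*} \left\{ \frac{\|K\eta^* e\|_X}{\|\eta K\eta^* e\|_Y} : e (\eta K\eta^* e) \ne 0 \right\} < \infty .$$ Then the operator $\eta^{-1} : \eta K \eta^* Y^* \to X$ (the inverse of the restriction of $\eta$ to $K\eta^*Y^*$) is continuous with norm $M$. Let $Y_0 := \overline{\eta K \eta^* Y^*}$ (closure in $Y$), and let $m : Y_0 \to X$ denote the continuous extension of $\eta^{-1}$ to all of $Y_0$. The map $\eta \circ m$ is the identity operator on $Y_0$. For any $y \in Y_0$, let $\mathbb{P}^y$ be the Gaussian measure on $X$ with mean $m(y)$ and covariance operator $\hat K = K - K\eta^* m^*$. Then (these measures exist and) the family of measures $\mathbb{P}^y$ is a continuous disintegration of $\mathbb{P}$ with respect to $\eta$ given $Y_0$.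
   Context: Banach spaces are real; $\mathcal{B}(X)$ is the Borel $\sigma$-algebra of $X$. A Radon probability measure on $X$ is Gaussian if every $f \in X^*$ is a (possibly degenerate) real Gaussian random variable under it. Its mean $\mu \in X$ and covariance operator $K : X^* \to X$ are characterized by $f(\mu) = \int_X f \, \mathrm{d}\mathbb{P}$ and $Kf = \int_X f(x)\, x \, \mathrm{d}\mathbb{P}(x) - f(\mu)\mu$ for all $f\in X^*$ (such $\mu$ and $K$ exist, and $K$ is continuous and linear). The mean and covariance operator determine the Gaussian measure. $\eta^* : Y^* \to X^*$ is the adjoint of $\eta$. The map $\eta$ is injective on the subspace $K\eta^*Y^* \subseteq X$, so it has an inverse $\eta^{-1} : \eta K\eta^* Y^* \to K\eta^*Y^* \subseteq X$. The supremum of the empty set of ratios is taken to be $0$. For $f \in X^*$, $m^* f = f\circ m \in Y_0^*$, and $K\eta^* m^* f$ means $K\eta^* e$ for any $e \in Y^*$ whose restriction to $Y_0$ is $m^*f$ (the value does not depend on the choice of $e$). Push-forward: $\mathbb{P}_Y = \mathbb{P}\circ\eta^{-1}$, i.e. $\mathbb{P}_Y(B)=\mathbb{P}(\eta^{-1}(B))$ for $B \in \mathcal{B}(Y)$. Disintegration: a disintegration (regular conditional probability) of $\mathbb{P}$ with respect to $\eta$ is a map $(y,B) \mapsto \mathbb{P}^y(B)$, $Y\times\mathcal{B}(X) \to \mathbb{R}$, such that (i) each $\mathbb{P}^y$ is a probability measure on $\mathcal{B}(X)$; (ii) for every $B \in \mathcal{B}(X)$, $y \mapsto \mathbb{P}^y(B)$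 is measurable; (iii) $\mathbb{P}^y(\eta^{-1}(y)) = 1$ for $\mathbb{P}_Y$-almost every $y$; (iv) for all integrable $f : X \to \mathbb{R}$, $\int_X f(x)\,\mathrm{d}\mathbb{P}(x) = \int_Y\int_X f(x)\,\mathrm{d}\mathbb{P}^y(x)\,\mathrm{d}\mathbb{P}_Y(y)$. If $Y_0 \subseteq Y$ is closed with $\mathbb{P}_Y(Y_0)=1$, it is a continuous disintegration given $Y_0$ if moreover: whenever $y_n \in Y_0$ and $y_n \to y$, $\mathbb{P}^{y_n}$ converges weakly to $\mathbb{P}^y$. A family specified only for $y\in Y_0$ is regarded as a disintegration by restricting (i)–(iv) to $y \in Y_0$, equivalently by setting $\mathbb{P}^y$ to be any fixed probability measure for $y \notin Y_0$. *)

(* Defs.v *)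
From mathcomp Require Import all_boot all_order all_algebra.
From mathcomp Require Import all_classical all_reals all_analysis measurable_realfun.
Set Implicit Arguments.
Unset Strict Implicit.
Unset Printing Implicit Defensive.
Import Order.TTheory GRing.Theory Num.Theory numFieldNormedType.Exports.
Local Open Scope classical_set_scope.
Local Open Scope ring_scope.

Record dual (R : realType) (X : normedModType R) := Dual {
  dual_fun :> {linear X -> R^o};
  dual_continuous : continuous dual_fun }.

Section adjoint.
Variables (R : realType) (X Y : normedModType R).
Variables (eta : {linear X -> Y}) (eta_cont : continuous eta).

Lemma adjoint_subproof (e : dual Y) : continuous (e \o eta).
Proof.
move=> x; apply: continuous_comp; first exact: eta_cont.
exact: (@dual_continuous _ _ e).
Qed.

Definition adjoint (e : dual Y) : dual X :=
  @Dual R X (e \o eta : {linear X -> R^o}) (@adjoint_subproof e).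

End adjoint.

Definition borel (T : ptopologicalType) := g_sigma_algebraType (@open T).

Section gaussian.
Variables (R : realType) (X : normedModType R).
Implicit Types (P : probability (borel X) R) (mu : X) (K : dual X -> X).
Local Open Scope ereal_scope.

Definition radon P := forall B : set (borel X), measurable B ->
  P B = ereal_sup [set P C | C in [set C : set X | compact C /\ C `<=` B]].

(* normal_prob a s has standard deviation s, but normal_prob a 0 is not a Dirac
   mass, hence the separate degenerate case. *)
Definition real_gaussian (nu : set (measurableTypeR R) -> \bar R) :=
  (exists a : R, forall A, measurable A -> nu A = \d_a A) \/
  (exists a s : R, (0 < s)%R /\
     forall A, measurable A -> nu A = normal_prob a s A).

Definition gaussian P := radon P /\
  forall f : dual X,
    real_gaussian (pushforward P (f : borel X -> measurableTypeR R)).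

Definition is_mean P mu :=
  forall f : dual X, (f mu)%:E = \int[P]_x (f x)%:E.

(* The X-valued integral of F is taken in the weak (Gelfand-Pettis) sense. *)
Definition weak_integral P (F : X -> X) (v : X) :=
  forall g : dual X,
    P.-integrable [set: borel X] (fun x => (g (F x))%:E) /\
    \int[P]_x (g (F x))%:E = (g v)%:E.

Definition is_covariance P mu K := forall f : dual X,
  exists2 v, weak_integral P (fun x => f x *: x)%R v &
    K f = (v - f mu *: mu)%R.

Definition gaussian_with P mu K :=
  [/\ gaussian P, is_mean P mu & is_covariance P mu K].

Definition weak_cvg (P_ : nat -> probability (borel X) R) P :=
  forall phi : X -> R, continuous phi -> [bounded phi x | x in [set: X]] ->
    (fun n => \int[P_ n]_x (phi x)%:E) @ \oo --> \int[P]_x (phi x)%:E.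

End gaussian.

Section disintegration.
Variables (R : realType) (X Y : normedModType R) (eta : X -> Y).
Variable P : probability (borel X) R.
Local Open Scope ereal_scope.

Definition law : set (borel Y) -> \bar R :=
  pushforward P (eta : borel X -> borel Y).

(* With Y0 = setT this is a disintegration of P with respect to eta; in general
   the family Q is only relevant, and only constrained, on Y0. *)
Definition disintegration_on (Y0 : set (borel Y))
    (Q : Y -> probability (borel X) R) :=
  [/\ forall B : set (borel X), measurable B ->
        measurable_fun Y0 (fun y => Q y B),
      {ae law, forall y, Y0 y -> Q y (eta @^-1` [set y]) = 1} &
      forall f : borel X -> R, P.-integrable [set: borel X] (EFin \o f) ->
        \int[P]_x (f x)%:E = \int[law]_(y in Y0) \int[Q y]_x (f x)%:E].

Definition continuous_disintegration (Y0 : set Y)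
    (Q : Y -> probability (borel X) R) :=
  [/\ closed Y0, law Y0 = 1, disintegration_on Y0 Q &
      forall (y_ : nat -> Y) (y : Y), (forall n, Y0 (y_ n)) ->
        y_ @ \oo --> y -> weak_cvg (fun n => Q (y_ n)) (Q y)].

End disintegration.

Section covariance_ratio.
Variables (R : realType) (X Y : normedModType R).
Variables (eta : {linear X -> Y}) (eta_cont : continuous eta).
Variable K : dual X -> X.

Let Keta (e : dual Y) : X := K (adjoint eta_cont e).

Definition Keta_range : set X := range Keta.

(* The element 0 encodes the convention that the supremum of no ratios is 0;
   it is otherwise harmless since ratios are nonnegative. *)
Definition ratio_sup : \bar R := ereal_sup (0%E |`
  [set (`|Keta e| / `|eta (Keta e)|)%:E
    | e in [set e : dual Y | e (eta (Keta e)) != 0]]).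

(* This is the inverse of eta restricted to Keta_range only when that restriction
   is injective; its values outside eta @` Keta_range are irrelevant. *)
Definition eta_inv : Y -> X := 'pinv_(fun=> 0) Keta_range eta.

(* m is a total function but only its restriction to the closure matters. *)
Definition eta_inv_extension (m : Y -> X) :=
  {within closure (eta @` Keta_range), continuous m} /\
  {in eta @` Keta_range, m =1 eta_inv}.

End covariance_ratio.

(* Operator norm of T, regarded as an operator on the subspace D. *)
Definition opnorm_on (R : realType) (X Y : normedModType R) (D : set Y)
    (T : Y -> X) : \bar R :=
  ereal_sup [set `|T y|%:E | y in D `&` [set y | `|y| <= 1]].

(* Main.v *)
From HB Require Import structures.
Require Import Defs.
From mathcomp Require Import all_boot all_order all_algebra finmap.
From mathcomp Require Import all_classical all_reals all_analysis measurable_realfun.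
From mathcomp Require Import giry ring lra.
Import Order.TTheory GRing.Theory Num.Theory numFieldNormedType.Exports.
Local Open Scope classical_set_scope.
Local Open Scope ring_scope.

(** Let Y0 be the closed span of the vectors eta (K (eta^* e)) and let
    C (f, g) = g (K f), which is the integral of f g under P.

    _The inverse and its extension._ If e (eta (K (eta^* e))) = 0 then
    K (eta^* e) = 0 by Cauchy-Schwarz for C; so finiteness of M says that eta
    expands every vector u of the range of K eta^* by at least 1/M
    ([ratio_bound]).  Hence eta is injective there, its inverse is M-Lipschitz
    and extends to Y0 by completeness, and the identities m (eta u) = u,
    eta (m y) = y and the linearity of m pass to the closure.

    _The conditional measures._ P is carried by the closed subspace
    E0 = eta^-1 (Y0): a point outside E0 is detected by some functional
    e \o eta of variance zero, so compact subsets of the complement are null,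
    and P is Radon ([prob_support]).  On E0 the residual x - m (eta x) is
    continuous, and the conditional measure at y is the law under P of
    x - m (eta x) + m y.  For f in the dual of X and e extending f \o m, the
    functional f of this point is f - e \o eta plus the constant f (m y); this
    gives a Gaussian law with mean m y and covariance K - K eta^* m^*
    ([cond_prob_gaussian]).  These measures concentrate on the fibres of eta
    because eta (m y) = y, and depend continuously on y because m does.

    _The disintegration formula._ Mix the conditional measures with respect to
    the law of eta.  Since f - e \o eta and e \o eta are uncorrelated, hence
    independent, Gaussian variables, each functional f has the same law under
    the mixture as under P ([mixture_marginal]).  Both measures are tight, and
    tight measures with the same one-dimensional marginals are equal
    ([tight_unique]); so the mixture is P.

    [tight_unique] also identifies any Gaussian measure with its mean and
    covariance ([gaussian_with_unique]), which reduces an arbitrary family of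
    Gaussian measures with the prescribed parameters to the one constructed
    here.  As for its proof, sign t is a bounded double limit of trigonometric
    polynomials, so the integrals of trigonometric functions of functionals
    determine those of products of signs of functionals.  Hence they determine
    the measure on the algebra of sets generated by the half-spaces, and finite
    unions of polyhedra separate disjoint compact sets.  The independence of uncorrelated Gaussian
    variables is the convolution identity for normal densities
    ([normal_convolution], [gauss_convolution]). *)

(** * Hahn-Banach extension and separation by continuous functionals *)

Section hahn_banach.
Variables (R : realType) (V : normedModType R).

Definition dual_of (f : V -> R) (C : R)
    (fD : forall a x y, f (a *: x + y) = a * f x + f y)
    (fC : forall x, `|f x| <= C * `|x|) : {g : dual V | g =1 f}.
Proof.
have lf : linear (f : V -> R^o) by move=> a x y; rewrite fD.
pose h : {linear V -> R^o} :=
  HB.pack (f : V -> R^o) (GRing.isLinear.Build R V R^o *:%R f lf).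
have hc : continuous h.
  apply: (@bounded_linear_continuous _ _ R^o h).
  apply: (proj2 (@linear_boundedP _ _ R^o h)).
  exists C; split; first exact: num_real.
  by move=> r Cr x; rewrite (le_trans (fC x))// ler_wpM2r// ltW.
by exists (Dual hc) => x.
Defined.

(** The graph of a partial linear functional of norm at most C.  Functionality
    follows: if (x, r) and (x, s) belong to G then so does (0, r - s), and
    domination forces r = s.  Graphs rather than functions make the union
    of a chain immediate. *)
Definition dominated_relation (C : R) (G : set (V * R)) :=
  [/\ G (0, 0),
      forall a x r y s, G (x, r) -> G (y, s) -> G (a *: x + y, a * r + s) &
      forall x r, G (x, r) -> r <= C * `|x|].

Lemma dominated_relation_bigcup C (F : set (set (V * R))) :
  F `<=` (dominated_relation C : set (set (V * R))) -> F !=set0 -> total_on F subset ->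
  dominated_relation C (\bigcup_(G in F) G).
Proof.
move=> FC [G0 FG0] Ftot; split.
- by exists G0 => //; have [] := FC _ FG0.
- move=> a x r y s [G FG Gxr] [H FH Hys].
  have [GH|HG] := Ftot _ _ FG FH.
  + by exists H => //; have [_ + _] := FC _ FH; apply => //; exact: GH.
  + by exists G => //; have [_ + _] := FC _ FG; apply => //; exact: HG.
- by move=> x r [G FG Gxr]; have [_ _] := FC _ FG; apply.
Qed.

(** The value a at the new vector v must lie above every r - C |x - v| and below
    every C |y + v| - s; the triangle inequality makes this possible. *)
Lemma dominated_relation_extend C (G : set (V * R)) v :
  0 <= C -> dominated_relation C G ->
  exists a, dominated_relation C
    [set p | exists t x r, G (x, r) /\ p = (x + t *: v, r + t * a)].
Proof.
move=> C0 [G0 GD GC].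
pose S := [set u | exists x r, G (x, r) /\ u = r - C * `|x - v|].
have SU x r y s : G (x, r) -> G (y, s) -> r - C * `|x - v| <= C * `|y + v| - s.
  move=> Gx Gy; rewrite lerBlDr addrAC lerBrDr.
  have := GD 1 x r y s Gx Gy; rewrite scale1r mul1r => /GC/le_trans; apply.
  rewrite -mulrDr ler_wpM2l// [leRHS]addrC.
  by rewrite (_ : x + y = (x - v) + (y + v)) ?ler_normD// addrACA addNr addr0.
have S0 : S !=set0 by exists (0 - C * `|0 - v|); exists 0, 0.
have ub y s : G (y, s) -> ubound S (C * `|y + v| - s).
  by move=> Gy _ [x [r [Gx ->]]]; exact: SU.
(* Any value between the two families of bounds would do. *)
pose a := sup S.
have aub y s : G (y, s) -> a <= C * `|y + v| - s.
  by move=> Gy; apply: ge_sup => //; exact: ub.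
have alb x r : G (x, r) -> r - C * `|x - v| <= a.
  move=> Gx; apply: ub_le_sup; last by exists x, r.
  by exists (C * `|0 + v| - 0); exact: ub.
have GZ t x r : G (x, r) -> G (t *: x, t * r).
  by move=> Gx; have := GD t x r 0 0 Gx G0; rewrite !addr0.
exists a; split.
- by exists 0, 0, 0; split => //; rewrite scale0r mul0r !addr0.
- move=> b x r y s [t [x' [r' [Gx [-> ->]]]]] [u [y' [s' [Gy [-> ->]]]]].
  exists (b * t + u), (b *: x' + y'), (b * r' + s'); split; first exact: GD.
  congr pair; last by ring.
  by rewrite scalerDr scalerA addrACA -scalerDl.
- move=> x r [t [x' [r' [Gx [-> ->]]]]].
  have [t0|t0|->] := ltgtP t 0; last first.
  + by rewrite scale0r mul0r !addr0; exact: GC.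
  + have le1 : a + t^-1 * r' <= C * `|t^-1 *: x' + v|.
      by rewrite -lerBrDr; exact/aub/GZ.
    have -> : r' + t * a = t * (a + t^-1 * r').
      by rewrite mulrDr mulrA mulfV ?gt_eqF// mul1r addrC.
    have -> : x' + t *: v = t *: (t^-1 *: x' + v).
      by rewrite scalerDr scalerA mulfV ?gt_eqF// scale1r.
    by rewrite normrZ gtr0_norm// mulrCA ler_wpM2l// ltW.
  + have nt0 : 0 < - t by rewrite oppr_gt0.
    have le1 : (- t)^-1 * r' - a <= C * `|(- t)^-1 *: x' - v|.
      by rewrite lerBlDr -lerBlDl; exact/alb/GZ.
    have -> : r' + t * a = (- t) * ((- t)^-1 * r' - a).
      by rewrite mulrBr mulrA mulfV ?gt_eqF// mul1r mulNr opprK.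
    have -> : x' + t *: v = (- t) *: ((- t)^-1 *: x' - v).
      by rewrite scalerBr scalerA mulfV ?gt_eqF// scale1r scaleNr opprK.
    by rewrite normrZ gtr0_norm// mulrCA ler_wpM2l// ltW.
Qed.

Theorem hahn_banach C (G : set (V * R)) : 0 <= C -> dominated_relation C G ->
  exists e : dual V, forall x r, G (x, r) -> e x = r.
Proof.
move=> C0 GC.
(* The empty set is admitted because Zorn's lemma also concerns the empty chain. *)
pose PP : set (set (V * R)) := [set H | H = set0 \/ (G `<=` H /\ dominated_relation C H)].
have [|H [PH Hmax]] := @Zorn_bigcup _ PP.
  move=> F FP Ftot.
  have [[H FH H0]|F0] := pselect (exists2 H, F H & H !=set0); last first.
    left; rewrite -subset0 => x [H FH Hx]; apply: F0; exists H => //; by exists x.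
  right.
  (* Dropping the empty set from the chain does not change its union. *)
  pose F' := F `&` [set H | H !=set0].
  have E : \bigcup_(X in F) X = \bigcup_(X in F') X.
    apply/seteqP; split => x [A FA Ax]; exists A => //; last by case: FA.
    by split => //; exists x.
  rewrite E.
  have F'P X : F' X -> G `<=` X /\ dominated_relation C X.
    by move=> [FX [x Xx]]; have [X0|//] := FP _ FX; move: Xx; rewrite X0.
  split; first by move=> x Gx; exists H => //; have [+ _] := F'P H (conj FH H0); apply.
  apply: dominated_relation_bigcup.
  - by move=> X /F'P[].
  - by exists H.
  - by move=> X Y [FX _] [FY _]; exact: Ftot.
have G00 : G (0, 0) by case: GC.
have {PH}[GH HC] : G `<=` H /\ dominated_relation C H.
  case: PH => [H0|//]; exfalso.
  apply: (Hmax G); last by right; split.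
  by rewrite H0; split => [x []|/(_ _ G00)].
have total v : exists r, H (v, r).
  have [a Ha] := dominated_relation_extend C H v C0 HC.
  set H' := (X in dominated_relation C X) in Ha.
  have HH' : H `<=` H'.
    by move=> [x r] Hx; exists 0, x, r; rewrite scale0r mul0r !addr0.
  have H'v : H' (v, a).
    exists 1, 0, 0; rewrite scale1r mul1r !add0r; split => //; exact: GH.
  have [HE|HE] := pselect (H' `<=` H); first by exists a; exact: HE.
  exfalso; apply: (Hmax H'); first by split.
  by right; split => //; exact: subset_trans HH'.
have [H0 HD HB] := HC.
have Huniq x r s : H (x, r) -> H (x, s) -> r = s.
  move=> Hr Hs.
  have h p q : H (x, p) -> H (x, q) -> p <= q.
    move=> Hp Hq; have := HB _ _ (HD (-1) _ _ _ _ Hq Hp).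
    by rewrite scaleN1r addNr normr0 mulr0 mulN1r addrC subr_le0.
  by apply/eqP; rewrite eq_le !h.
pose f v := projT1 (cid (total v)).
have Hf v : H (v, f v) by rewrite /f; case: cid.
have fD a x y : f (a *: x + y) = a * f x + f y.
  by apply: (Huniq (a *: x + y)) => //; exact: HD.
have fC x : `|f x| <= C * `|x|.
  rewrite ler_norml HB// andbT lerNl.
  have := HB _ _ (HD (-1) _ _ _ _ (Hf x) (H0)).
  by rewrite scaleN1r !addr0 normrN mulN1r.
have [e ef] := dual_of f C fD fC.
by exists e => x r /GH Hx; rewrite ef; apply: Huniq Hx.
Qed.

End hahn_banach.

Section separation.
Variables (R : realType) (V : normedModType R).

(** The functional u + t y |-> t d on F + R y, with d the distance from y to F,
    has norm at most 1. *)
Lemma dual_separates_closed (F : set V) (y : V) :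
  F 0 -> (forall a u v, F u -> F v -> F (a *: u + v)) -> closed F -> ~ F y ->
  exists2 e : dual V, (forall u, F u -> e u = 0) & e y != 0.
Proof.
move=> F0 FD cF Fy.
have /nbhs_normP[d /= d0 dF] : nbhs y (~` F).
  by apply: open_nbhs_nbhs; split => //; exact: closed_openC.
have FZ a u : F u -> F (a *: u) by move=> Fu; rewrite -[_ *: _]addr0; exact: FD.
have far u : F u -> d <= `|y - u|.
  by move=> Fu; rewrite leNgt; apply/negP => yu; exact: (dF u).
pose G := [set p : V * R | exists2 u, F u & exists t, p = (u + t *: y, t * d)].
have [||e eG] := @hahn_banach R V 1 G; first exact: ler01.
- split.
  + by exists 0 => //; exists 0; rewrite scale0r mul0r addr0.
  + move=> a x r z s [u Fu [t [-> ->]]] [v Fv [t' [-> ->]]].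
    exists (a *: u + v); first exact: FD.
    exists (a * t + t'); congr pair; last by ring.
    by rewrite scalerDr scalerA addrACA -scalerDl.
  + move=> x r [u Fu [t [-> ->]]]; rewrite mul1r.
    have [->|t0] := eqVneq t 0; first by rewrite mul0r normr_ge0.
    have -> : u + t *: y = t *: (y - (- t^-1) *: u).
      by rewrite scaleNr opprK scalerDr scalerA mulfV// scale1r addrC.
    rewrite normrZ (le_trans (ler_wpM2r (ltW d0) (ler_norm t)))//.
    by rewrite ler_wpM2l// far//; exact: FZ.
exists e.
  by move=> u Fu; apply: eG; exists u => //; exists 0; rewrite scale0r mul0r addr0.
rewrite (eG y d) ?gt_eqF//; exists 0 => //; exists 1.
by rewrite scale1r mul1r add0r.
Qed.

Lemma dual_separates (x y : V) : (forall e : dual V, e x = e y) -> x = y.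
Proof.
move=> exy; apply/eqP; rewrite -subr_eq0; apply/negPn/negP => /eqP xy0.
have cl0 : closed [set (0 : V)].
  exact: accessible_closed_set1 (hausdorff_accessible (@norm_hausdorff _ V)) _.
have [||||e _] := @dual_separates_closed [set 0] (x - y).
- by [].
- by move=> a u v -> ->; rewrite scaler0 addr0.
- exact: cl0.
- exact: xy0.
- by rewrite linearB /= exy subrr eqxx.
Qed.

Lemma dual_extension (F : set V) (f : V -> R) (C : R) :
  0 <= C -> F 0 -> (forall a u v, F u -> F v -> F (a *: u + v)) ->
  (forall a u v, F u -> F v -> f (a *: u + v) = a * f u + f v) ->
  (forall u, F u -> `|f u| <= C * `|u|) ->
  exists e : dual V, forall u, F u -> e u = f u.
Proof.
move=> C0 F0 FD fD fC.
have f0 : f 0 = 0.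
  by apply/eqP; rewrite -normr_le0 (le_trans (fC _ F0))// normr0 mulr0.
have [|e eG] := @hahn_banach R V C [set p | F p.1 /\ p.2 = f p.1] C0.
- split => /=.
  + by [].
  + by move=> a x r y s [Fx ->] [Fy ->]; rewrite fD//; split => //; exact: FD.
  + by move=> x r [Fx ->]; rewrite (le_trans (ler_norm _))// fC.
by exists e => u Fu; exact: eG.
Qed.

Lemma dual_bounded (f : dual V) : exists2 C, 0 <= C & forall x, `|f x| <= C * `|x|.
Proof.
have /(_ 0)/(@continuous_linear_bounded _ _ R^o) := @dual_continuous _ _ f.
move=> fb; have [M [_ MP]] := proj1 (@linear_boundedP _ _ R^o f) (fb 0).
exists (`|M| + 1); first by rewrite addr_ge0.
by apply: MP; rewrite (le_lt_trans (ler_norm _))// ltrDl.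
Qed.

(** Stands in for a vector space structure on the dual. *)
Lemma dual_comb (a : R) (f g : dual V) : {h : dual V | forall x, h x = a * f x + g x}.
Proof.
apply: cid.
have [C C0 fC] := dual_bounded f; have [D D0 gD] := dual_bounded g.
have [||h hE] := @dual_of R V (fun x => a * f x + g x) (`|a| * C + D).
- by move=> b x y; rewrite !linearP /= /GRing.scale/=; ring.
- move=> x; rewrite (le_trans (ler_normD _ _))// mulrDl lerD//.
  by rewrite normrM -mulrA ler_wpM2l.
- by exists h => x; rewrite hE.
Qed.

End separation.

Arguments dual_comb {R V} a f g.
Arguments dual_bounded {R V} f.
Arguments dual_separates {R V} x y.
Arguments dual_separates_closed {R V} F y.
Arguments dual_extension {R V} F f C.

(** * Borel sets and integrals of bounded functions *)

Section borel_measurability.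

Lemma open_borel (T : ptopologicalType) (A : set T) :
  open A -> measurable (A : set (borel T)).
Proof. exact: sub_sigma_algebra. Qed.

Lemma closed_borel (T : ptopologicalType) (A : set T) :
  closed A -> measurable (A : set (borel T)).
Proof.
move=> cA; rewrite -(setCK A); apply: measurableC.
by apply: open_borel; exact: closed_openC.
Qed.

Lemma compact_borel (R : realType) (V : normedModType R) (A : set V) :
  compact A -> measurable (A : set (borel V)).
Proof.
move=> cA; apply: closed_borel; apply: compact_closed; last exact: cA.
exact: (@norm_hausdorff _ V).
Qed.

Lemma within_continuous_borel (S T : ptopologicalType) (D : set S) (f : S -> T) :
  measurable (D : set (borel S)) -> {within D, continuous f} ->
  measurable_fun (D : set (borel S)) (f : borel S -> borel T).
Proof.
move=> mD fc; apply: (@measurability _ _ (borel S) (borel T) D f (@open T) erefl).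
move=> _ [B oB <-].
have : open ((f : subspace D -> T) @^-1` B) by move/continuousP : fc; apply.
by move=> /open_subspaceP[V oV VE]; rewrite setIC -VE; apply: measurableI => //; exact: open_borel.
Qed.

Lemma continuous_borel (S T : ptopologicalType) (f : S -> T) : continuous f ->
  measurable_fun setT (f : borel S -> borel T).
Proof.
by move=> fc; apply: within_continuous_borel => //; exact: continuous_subspaceT.
Qed.


Lemma continuous_measurable_real (R : realType) (S : ptopologicalType) (f : S -> R) :
  continuous f -> measurable_fun setT (f : borel S -> measurableTypeR R).
Proof.
move=> fc; apply: (measurability _ (RGenOInfty.measurableE R)).
move=> _ [_ [a ->] <-]; rewrite setTI; apply: open_borel.
by move/continuousP : fc; apply; exact: rray_open.
Qed.

Lemma measurable_cos_shift (R : realType) (c : R) :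
  measurable_fun setT (fun t : R => cos (t + c)).
Proof.
apply: measurableT_comp; last exact: measurable_funD.
by apply: continuous_measurable_fun; exact: continuous_cos.
Qed.

End borel_measurability.

Section bounded_integrals.
Context d (T : measurableType d) (R : realType) (P : probability T R).

Lemma integral_prob_cst (r : \bar R) : (\int[P]_x r = r)%E.
Proof.
rewrite integral_cst// -[RHS]mule1; congr (_ * _)%E; exact: probability_setT.
Qed.

Lemma bounded_integrable (f : T -> R) (C : R) :
  measurable_fun setT f -> (forall x, `|f x| <= C) ->
  P.-integrable setT (EFin \o f).
Proof.
move=> mf fC; apply: measurable_bounded_integrable => //.
  by rewrite (le_lt_trans (probability_le1 P measurableT)) ?ltry.
exists C; split; first exact: num_real.
by move=> r Cr x _; exact: le_trans (fC x) (ltW Cr).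
Qed.

Lemma bounded_cvg_integral (f_ : nat -> T -> R) (f : T -> R) (C : R) :
  (forall n, measurable_fun setT (f_ n)) -> (forall n x, `|f_ n x| <= C) ->
  (forall x, f_ n x @[n --> \oo] --> f x) ->
  (\int[P]_x (f_ n x)%:E @[n --> \oo] --> \int[P]_x (f x)%:E)%E.
Proof.
move=> mf fC cf.
apply: (@dominated_cvg _ _ _ P _ measurableT _ _ (fun=> C%:E)) => //.
- by move=> n; exact/measurable_EFinP.
- by move=> x _; apply: cvg_EFin => //; [exact: nearW|exact: cf].
- by apply: (bounded_integrable (cst C) `|C|).
- by move=> n x _; rewrite /= lee_fin.
Qed.

End bounded_integrals.

Arguments integral_prob_cst {d T R} P r.
Arguments bounded_integrable {d T R} P f C.
Arguments bounded_cvg_integral {d T R P} f_ f C.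
Arguments open_borel {T} A.
Arguments closed_borel {T} A.
Arguments compact_borel {R V} A.
Arguments within_continuous_borel {S T} D f.
Arguments continuous_borel {S T} f.
Arguments continuous_measurable_real {R S} f.

Section image_measure.
Local Open Scope ereal_scope.
Context d d' (T : measurableType d) (T' : measurableType d') (R : realType).
Variables (f : T -> T') (mf : measurable_fun setT f).

(** The measure structure on a push-forward depends on the measurability proof,
    which cannot be inferred from the function. *)
Definition image_measure (m : {measure set T -> \bar R}) : {measure set T' -> \bar R} :=
  measure_function_pushforward__canonical__measure_function_Measure m mf.

Variable P : probability T R.

Let image_setT : image_measure P setT = 1.
Proof. exact: probability_setT. Qed.

Definition image_prob : probability T' R :=
  HB.pack (image_measure P : set T' -> \bar R) (Measure.class (image_measure P))
    (Measure_isProbability.Build _ _ _ (image_measure P) image_setT).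

End image_measure.

Arguments image_measure {d d' T T' R f} mf m.
Arguments image_prob {d d' T T' R f} mf P.

(** * The sign function as a limit of trigonometric polynomials *)

Section sign_approximation.
Variable R : realType.
Implicit Types s x : R.

(** The iterates of this odd cubic, with fixed points -1, 0 and 1, drive every
    point of [-1, 1] to its sign. *)
Definition cubic s : R := (3 * s - s ^+ 3) / 2.

Lemma cubicN s : cubic (- s) = - cubic s.
Proof. by rewrite /cubic; ring. Qed.

Lemma iter_cubicN n s : iter n cubic (- s) = - iter n cubic s.
Proof. by elim: n => //= n ->; rewrite cubicN. Qed.

Lemma iter_cubic0 n : iter n cubic 0 = 0.
Proof. by elim: n => //= n ->; rewrite /cubic mulr0 expr0n subrr mul0r. Qed.

(** 1 - cubic s = (1 - s)^2 (2 + s) / 2, so each step contracts the distance to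
    1 by the factor (1 - s) (2 + s) / 2, which is at most 1 - s0 / 2 on
    [s0, 1]. *)
Lemma iter_cubic_bounds s0 n : 0 < s0 -> s0 <= 1 ->
  s0 <= iter n cubic s0 <= 1 /\ 1 - iter n cubic s0 <= (1 - s0 / 2) ^+ n.
Proof.
move=> s0p s01; elim: n => [|n [/andP[]]] /=.
  by rewrite lexx s01 expr0; split => //; rewrite lerBlDr lerDl ltW.
set s := iter n cubic s0 => ls sl IH.
have E : 1 - cubic s = (1 - s) * ((1 - s) * (2 + s) / 2) by rewrite /cubic; field.
have sq : s <= cubic s.
  have : 0 <= cubic s - s.
    have -> : cubic s - s = s * ((1 - s) * (1 + s)) / 2 by rewrite /cubic; field.
    by rewrite divr_ge0// !mulr_ge0//; lra.
  by rewrite subr_ge0.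
have fac : 0 <= (1 - s) * (2 + s) / 2 <= 1 - s0 / 2 by apply/andP; split; nra.
split.
  rewrite (le_trans ls)//= -subr_ge0 E mulr_ge0//; first by lra.
  by case/andP: fac.
rewrite E exprSr; apply: ler_pM => //; first by lra.
- by case/andP: fac.
- by case/andP: fac.
Qed.

Lemma iter_cubic_le1 n s : `|s| <= 1 -> `|iter n cubic s| <= 1.
Proof.
have pos t : 0 < t -> t <= 1 -> `|iter n cubic t| <= 1.
  move=> t0 t1; have [/andP[lt tl] _] := iter_cubic_bounds t n t0 t1.
  by rewrite ger0_norm// (le_trans (ltW t0)).
have [s0|s0|->] := ltgtP s 0.
- move=> sl; rewrite -[s]opprK iter_cubicN normrN pos// ?oppr_gt0//.
  by rewrite -(ltr0_norm s0).
- by move=> sl; rewrite pos // -(gtr0_norm s0).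
- by rewrite iter_cubic0 normr0.
Qed.

Lemma iter_cubic_cvg s : `|s| <= 1 -> iter n cubic s @[n --> \oo] --> Num.sg s.
Proof.
have pos t : 0 < t -> t <= 1 -> iter n cubic t @[n --> \oo] --> (1 : R).
  move=> t0 t1; rewrite -[X in _ --> X]subr0.
  have E : (fun n => iter n cubic t) = (fun n => 1 - (1 - iter n cubic t)).
    by apply/funext => n; rewrite subKr.
  rewrite E; apply: cvgB; first exact: cvg_cst.
  apply: (@squeeze_cvgr _ _ _ _ (cst 0) (fun n => (1 - t / 2) ^+ n)).
  - apply: nearW => n /=; have [/andP[lt tl] h] := iter_cubic_bounds t n t0 t1.
    by rewrite h andbT subr_ge0.
  - exact: cvg_cst.
  - by apply: cvg_expr; rewrite ger0_norm; lra.
have [s0|s0|->] := ltgtP s 0.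
- move=> sl; rewrite ltr0_sg//.
  have -> : (fun n => iter n cubic s) = (fun n => - iter n cubic (- s)).
    by apply/funext => n; rewrite iter_cubicN opprK.
  by apply: cvgN; apply: pos; rewrite ?oppr_gt0// -(ltr0_norm s0).
- by move=> sl; rewrite gtr0_sg//; apply: pos => //; rewrite -(gtr0_norm s0).
- by move=> _; under eq_fun do rewrite iter_cubic0; rewrite sgr0; exact: cvg_cst.
Qed.

(** As soon as |x| / 2^n < pi, the sine of x / 2^n has the sign of x. *)
Lemma sg_sin_cvg x : Num.sg (sin (x / 2 ^+ n)) @[n --> \oo] --> Num.sg x.
Proof.
have pos (y : R) : 0 < y -> \forall n \near \oo, Num.sg (sin (y / 2 ^+ n)) = 1.
  move=> y0.
  have c : y * (2^-1 : R) ^+ n @[n --> \oo] --> (0 : R).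
    by rewrite -(mulr0 y); apply: cvgMr; apply: cvg_expr; rewrite ger0_norm; lra.
  near=> n.
  rewrite gtr0_sg// sin_gt0_pi// divr_gt0//=  ?exprn_gt0//=.
  rewrite -exprVn; near: n.
  by apply: (cvgr_lt (0:R)); [exact: c|exact: pi_gt0].
have [x0|x0|->] := ltgtP x 0.
- have x1 := pos (- x); rewrite oppr_gt0 in x1.
  rewrite ltr0_sg//; apply: cvg_near_cst.
  apply: filterS (x1 x0) => n /=; rewrite mulNr sinN sgrN => /eqP.
  by rewrite eqr_oppLR => /eqP.
- rewrite gtr0_sg//; apply: cvg_near_cst; exact: pos.
- by under eq_fun do rewrite mul0r sin0 sgr0; rewrite sgr0; exact: cvg_cst.
Unshelve. all: by end_near. Qed.

End sign_approximation.

Arguments cubic {R} s.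

(** * Trigonometric polynomials on a normed space *)

Section trig.
Variables (R : realType) (X : normedModType R).

(** The phase c makes the class contain the sines, and makes its closure under
    products a single addition formula. *)
Inductive trig : (X -> R) -> Prop :=
| trig_cos (f : dual X) (c : R) : trig (fun x => cos (f x + c))
| trig_lin (a : R) (g h : X -> R) : trig g -> trig h ->
    trig (fun x => a * g x + h x).

Lemma trig_ext g h : g =1 h -> trig g -> trig h.
Proof. by move=> /funext ->. Qed.

Lemma trig_const (c : R) : trig (fun=> c).
Proof.
pose z : dual X := Dual (@cst_continuous X R^o 0 : continuous (\0 : {linear X -> R^o})).
have t := trig_cos z 0.
have t0 : trig (fun=> 0) by apply: trig_ext (trig_lin (-1) _ _ t t) => x; ring.
by apply: trig_ext (trig_lin c _ _ t t0) => x /=; rewrite !addr0 cos0 mulr1.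
Qed.

Lemma trigZ a g : trig g -> trig (fun x => a * g x).
Proof. by move=> tg; apply: trig_ext (trig_lin a _ _ tg (trig_const 0)) => x; rewrite addr0. Qed.

Lemma trigM g h : trig g -> trig h -> trig (fun x => g x * h x).
Proof.
move=> tg th; elim: tg => [f c|a g1 g2 _ IH1 _ IH2]; last first.
  by apply: trig_ext (trig_lin a _ _ IH1 IH2) => x; ring.
elim: th => [f' c'|a g1 g2 _ IH1 _ IH2]; last first.
  by apply: trig_ext (trig_lin a _ _ IH1 IH2) => x; ring.
have [p pE] := dual_comb 1 f f'; have [q qE] := dual_comb (-1) f' f.
apply: trig_ext (trig_lin 2^-1 _ _ (trig_cos p (c + c')) (trigZ 2^-1 _ (trig_cos q (c - c')))) => x.
rewrite pE qE.
have -> : 1 * f x + f' x + (c + c') = (f x + c) + (f' x + c') by ring.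
have -> : -1 * f' x + f x + (c - c') = (f x + c) - (f' x + c') by ring.
by rewrite cosD cosB; field.
Qed.

Lemma trig_cubic g n : trig g -> trig (fun x => iter n cubic (g x)).
Proof.
elim: n => //= n IH tg; have t := IH tg.
apply: trig_ext (trig_lin (3 / 2) _ _ t (trigZ (- 2^-1) _ (trigM _ _ t (trigM _ _ t t)))) => x.
by rewrite /cubic; ring.
Qed.

Lemma trig_sin (f : dual X) (c b : R) : trig (fun x => sin ((f x + c) * b)).
Proof.
have [z zE] := dual_comb (-1) f f; have [p pE] := dual_comb b f z.
apply: trig_ext (trig_cos p (c * b - pi / 2)) => x.
rewrite pE zE (_ : _ + _ = (f x + c) * b - pi / 2); last by ring.
by rewrite cosBpihalf.
Qed.

Lemma trig_continuous g : trig g -> continuous g.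
Proof.
elim=> [f c|a g1 g2 _ IH1 _ IH2] x.
  apply: (@continuous_comp _ _ _ (fun x => f x + c) cos); last exact: continuous_cos.
  by apply: (@continuousD _ R^o); [exact: (@dual_continuous _ _ f)|exact: cst_continuous].
apply: cvgD; last exact: IH2.
by apply: cvgM; [exact: cvg_cst|exact: IH1].
Qed.

Lemma trig_bounded g : trig g -> exists C, forall x, `|g x| <= C.
Proof.
elim=> [f c|a g1 g2 _ [C1 IH1] _ [C2 IH2]].
  by exists 1 => x; rewrite ler_norml cos_geN1 cos_le1.
exists (`|a| * C1 + C2) => x.
by rewrite (le_trans (ler_normD _ _))// normrM lerD// ler_wpM2l.
Qed.

End trig.

Arguments trig {R X}.
Arguments trig_bounded {R X} g.
Arguments trig_continuous {R X} g.
Arguments trigM {R X} g h.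
Arguments trig_const {R} X c.
Arguments trig_cubic {R X} g n.

Section bounded_linear_combination.
Context d (T : measurableType d) (R : realType) (P : probability T R).

Lemma bounded_integral_lin (a : R) (u v : T -> R) (C D : R) :
  measurable_fun setT u -> measurable_fun setT v ->
  (forall x, `|u x| <= C) -> (forall x, `|v x| <= D) ->
  (\int[P]_x (a * u x + v x)%:E = a%:E * \int[P]_x (u x)%:E + \int[P]_x (v x)%:E)%E.
Proof.
move=> mu mv uC vD.
have iu := bounded_integrable P u C mu uC.
have iv := bounded_integrable P v D mv vD.
under eq_integral do rewrite EFinD EFinM.
rewrite (@integralD _ _ _ P _ measurableT (fun x => a%:E * (u x)%:E)%E _ _ iv); last exact: integrableZl.
by rewrite integralZl.
Qed.

End bounded_linear_combination.

Arguments bounded_integral_lin {d T R} P a u v C D.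

(** * From trigonometric integrals to polyhedra *)

Section uniqueness.
Variables (R : realType) (X : normedModType R).
Variables mu nu : probability (borel X) R.
Local Notation mfun w := (measurable_fun setT (w : borel X -> measurableTypeR R)).

Hypothesis cos_eq : forall (f : dual X) (c : R),
  (\int[mu]_x (cos (f x + c))%:E = \int[nu]_x (cos (f x + c))%:E)%E.

Lemma trig_eq (h : X -> R) : trig h ->
  (\int[mu]_x (h x)%:E = \int[nu]_x (h x)%:E)%E.
Proof.
elim=> [//|a g1 g2 t1 IH1 t2 IH2].
have [C1 b1] := trig_bounded g1 t1; have [C2 b2] := trig_bounded g2 t2.
have m1 := continuous_measurable_real _ (trig_continuous g1 t1).
have m2 := continuous_measurable_real _ (trig_continuous g2 t2).
by rewrite !(bounded_integral_lin _ _ _ _ C1 C2)// IH1 IH2.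
Qed.

(** The weight h makes the class stable under multiplication by trigonometric
    polynomials, hence by signs of functionals; equality of the integrals of w
    alone would not be inherited by products. *)
Definition multiplier (w : X -> R) :=
  [/\ mfun w, exists C, forall x, `|w x| <= C &
     forall h, trig h -> (\int[mu]_x (w x * h x)%:E = \int[nu]_x (w x * h x)%:E)%E].

Lemma multiplier_ext u v : u =1 v -> multiplier u -> multiplier v.
Proof. by move=> /funext ->. Qed.

Lemma multiplier1 : multiplier (fun=> 1).
Proof.
split; first exact: measurable_cst.
  by exists 1 => x; rewrite normr1.
move=> h /trig_eq; under [in X in _ -> X = _]eq_integral do rewrite mul1r.
by under [in X in _ -> _ = X]eq_integral do rewrite mul1r.
Qed.

Lemma multiplier_lin a u v : multiplier u -> multiplier v ->
  multiplier (fun x => a * u x + v x).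
Proof.
move=> [mu1 [C1 b1] e1] [mu2 [C2 b2] e2]; split.
- by apply: measurable_funD => //; apply: measurable_funM.
- exists (`|a| * C1 + C2) => x.
  by rewrite (le_trans (ler_normD _ _))// normrM lerD// ler_wpM2l.
move=> h th; have [D bD] := trig_bounded h th.
have mh := continuous_measurable_real _ (trig_continuous h th).
have E (P : probability (borel X) R) :
  (\int[P]_x ((a * u x + v x) * h x)%:E = \int[P]_x (a * (u x * h x) + v x * h x)%:E)%E.
  by apply: eq_integral => x _; congr EFin; ring.
rewrite !E !(bounded_integral_lin _ _ _ _ (C1 * D) (C2 * D)) ?e1 ?e2//;
  try exact: measurable_funM;
  by move=> x; rewrite normrM ler_pM.
Qed.

Lemma multiplier_cvg (w_ : nat -> X -> R) (w : X -> R) (C : R) :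
  (forall n, multiplier (w_ n)) -> (forall n x, `|w_ n x| <= C) ->
  (forall x, w_ n x @[n --> \oo] --> w x) -> multiplier w.
Proof.
move=> mw wC cw.
have mfw : mfun w.
  by apply: (@measurable_fun_cvg _ (borel X) R setT w_ w) => [n|x _]; [case: (mw n)|exact: cw].
have bw x : `|w x| <= C.
  have c : `|w_ n x| @[n --> \oo] --> `|w x| by apply: cvg_norm; exact: cw.
  rewrite -(cvg_lim _ c)//; apply: limr_le; first by apply/cvg_ex; exists `|w x|.
  exact: nearW.
split => //; first by exists C.
move=> h th; have [D bD] := trig_bounded h th.
have mh := continuous_measurable_real _ (trig_continuous h th).
have lim (P : probability (borel X) R) :
    (\int[P]_x (w_ n x * h x)%:E @[n --> \oo] --> \int[P]_x (w x * h x)%:E)%E.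
  apply: (@bounded_cvg_integral _ _ _ P _ _ (C * D)).
  - by move=> n; apply: measurable_funM => //; case: (mw n).
  - by move=> n x; rewrite normrM ler_pM.
  - by move=> x; apply: cvgM; [exact: cw|exact: cvg_cst].
rewrite -(cvg_lim _ (lim mu))// -(cvg_lim _ (lim nu))//.
congr (limn _); apply/funext => n; have [_ _] := mw n; exact.
Qed.

Lemma multiplier_trig w g : multiplier w -> trig g -> multiplier (fun x => g x * w x).
Proof.
move=> [mw [C bw] ew] tg; have [D bD] := trig_bounded g tg.
have mg := continuous_measurable_real _ (trig_continuous g tg).
split.
- exact: measurable_funM.
- by exists (D * C) => x; rewrite normrM ler_pM.
- move=> h th; have := ew _ (trigM _ _ tg th).
  by under eq_integral do rewrite mulrCA mulrA;
    under [X in _ = X -> _]eq_integral do rewrite mulrCA mulrA.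
Qed.

(** The sign is reached by two successive bounded limits: the iterated cubic of
    sin ((f - a) / 2^n) tends to its sign, and these signs tend to that of
    f - a. *)
Lemma multiplier_sg w (f : dual X) (a : R) : multiplier w ->
  multiplier (fun x => Num.sg (f x - a) * w x).
Proof.
move=> mw; have [_ [C bw] _] := mw.
have bsg (t : R) : `|Num.sg t| <= 1 by rewrite normr_sg lern1 leq_b1.
apply: (@multiplier_cvg (fun n x => Num.sg (sin ((f x - a) / 2 ^+ n)) * w x) _ C).
- move=> n.
  apply: (@multiplier_cvg (fun k x => iter k cubic (sin ((f x - a) / 2 ^+ n)) * w x) _ C).
  + by move=> k; apply: multiplier_trig => //; apply: trig_cubic; exact: trig_sin.
  + move=> k x; rewrite normrM -[leRHS]mul1r ler_pM//.
    by rewrite iter_cubic_le1// ler_norml sin_geN1 sin_le1.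
  + move=> x; apply: cvgM; last exact: cvg_cst.
    by apply: iter_cubic_cvg; rewrite ler_norml sin_geN1 sin_le1.
- by move=> n x; rewrite normrM -[leRHS]mul1r ler_pM.
- by move=> x; apply: cvgM; [exact: sg_sin_cvg|exact: cvg_cst].
Qed.

(** Quantifying over all multipliers w makes these sets an algebra. *)
Definition stable (A : set X) := measurable (A : set (borel X)) /\
  forall w, multiplier w -> multiplier (fun x => \1_A x * w x).

(** The indicator of t > 0 is (sg t + (sg t)^2) / 2. *)
Lemma stable_halfspace (f : dual X) (a : R) : stable [set x | a < f x].
Proof.
split.
  apply: open_borel.
  have /continuousP fc : continuous (f : X -> R) by exact: (@dual_continuous _ _ f).
  exact: (fc _ (@open_gt R a)).
move=> w mw.
have m1 := multiplier_sg w f a mw; have m2 := multiplier_sg _ f a m1.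
have m := multiplier_lin 2^-1 _ _ m1 (multiplier_lin 2^-1 _ _ m2 (multiplier_lin 0 _ _ mw (multiplier_lin (-1) _ _ mw mw))).
apply: multiplier_ext m => x; have E : (x \in [set x | a < f x]) = (0 < f x - a).
  by rewrite subr_gt0; apply/idP/idP; rewrite inE.
rewrite indicE E.
by case: sgrP => _ /=; field.
Qed.

Lemma stableC A : stable A -> stable (~` A).
Proof.
move=> [mA sA]; split; first exact: measurableC.
move=> w mw; have m := multiplier_lin (-1) _ _ (sA w mw) mw.
by apply: multiplier_ext m => x; rewrite !indicE in_setC; case: (x \in A) => /=; ring.
Qed.

Lemma stableI A B : stable A -> stable B -> stable (A `&` B).
Proof.
move=> [mA sA] [mB sB]; split; first exact: measurableI.
move=> w mw; have m := sA _ (sB _ mw).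
by apply: multiplier_ext m => x; rewrite indicI /= mulrA.
Qed.

Lemma stableU A B : stable A -> stable B -> stable (A `|` B).
Proof.
move=> sA sB; rewrite -(setCK (A `|` B)) setCU.
by apply: stableC; apply: stableI; exact: stableC.
Qed.

Lemma stable_eq A : stable A -> mu A = nu A.
Proof.
move=> [mA sA]; have [_ _ /(_ _ (trig_const X 1))] := sA _ multiplier1.
have E (P : probability (borel X) R) :
  (\int[P]_x (\1_A x * 1 * 1)%:E = P A)%E.
  by under eq_integral do rewrite !mulr1; rewrite integral_indic// setIT.
by rewrite !E.
Qed.

End uniqueness.

Arguments multiplier {R X} mu nu w.
Arguments multiplier_lin {R X mu nu} a u v.
Arguments multiplier_ext {R X mu nu} u v.
Arguments stable {R X} mu nu A.
Arguments stable_halfspace {R X mu nu} f a.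
Arguments stable_eq {R X mu nu} cos_eq A.

(** * Tight measures and their uniqueness *)

(** Induction over compact sets: a property of sets that is stable under finite
    unions and holds locally holds on a neighbourhood of a compact set. *)
Lemma compact_ind (T : ptopologicalType) (K : set T) (Q : set T -> Prop) :
  compact K -> Q set0 -> (forall A B, Q A -> Q B -> Q (A `|` B)) ->
  (forall x, K x -> exists U, [/\ open U, U x & Q U]) ->
  exists2 A, K `<=` A & Q A.
Proof.
move=> cK0 Q0 QU Qloc.
have cK : cover_compact K by rewrite -compact_cover.
have [||D DQ KD] := cK (set T) [set U | open U /\ Q U] id.
- by move=> U [].
- by move=> x /Qloc[U [oU Ux QU']]; exists U.
exists (cover [set` D] id) => //.
rewrite /cover /= bigcup_fset.
rewrite big_seq; elim/big_ind : _ => //.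
by move=> U /DQ; rewrite inE => -[].
Qed.

Section tightness.
Variables (R : realType) (X : normedModType R).
Implicit Types mu nu : probability (borel X) R.
Local Open Scope ereal_scope.

Definition tight mu :=
  forall e : R, (0 < e)%R -> exists2 K : set X, compact K & (1 - e)%:E <= mu K.

Lemma radon_tight mu : radon mu -> tight mu.
Proof.
move=> rmu e e0.
have := rmu setT measurableT; rewrite probability_setT => E.
have : (1 - e)%:E < ereal_sup [set mu C | C in [set C : set X | compact C /\ C `<=` setT]].
  by rewrite -E lte_fin ltrBlDr ltrDl.
by move=> /ereal_sup_gt[_ [C [cC _] <-]] /ltW; exists C.
Qed.

Lemma prob_setIcompact mu (e : R) (A K : set (borel X)) :
  measurable A -> measurable K -> (1 - e)%:E <= mu K -> mu A <= mu (A `&` K) + e%:E.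
Proof.
move=> mA mK Ke.
have -> : mu A = mu (A `&` K) + mu (A `&` ~` K).
  rewrite -measureU//; [|exact: measurableI|by apply: measurableI => //; exact: measurableC|].
    by rewrite -setIUr setUv setIT.
  by rewrite setIACA setICr setI0.
rewrite leeD2l//.
apply: (@le_trans _ _ (mu (~` K))).
  by apply: le_measure; rewrite ?inE//; [apply: measurableI => //|]; exact: measurableC.
rewrite probability_setC// -(fineK (fin_num_measure mu K mK)) in Ke *.
by move: Ke; rewrite -EFinB !lee_fin; lra.
Qed.

(* points at distance at least 1/(n+1) from the complement *)
Definition shrink (U : set X) (n : nat) : set X :=
  [set x | forall y, (`|x - y| < n.+1%:R^-1)%R -> U y].

Lemma shrink_closed U n : closed (shrink U n).
Proof.
rewrite -[shrink U n]setCK; apply: open_closedC.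
rewrite openE => x /existsNP[y /not_implyP[xy Uy]].
have d0 : (0 < n.+1%:R^-1 - `|x - y|)%R by rewrite subr_gt0.
apply/nbhs_normP; exists (n.+1%:R^-1 - `|x - y|)%R => //= z xz /(_ y); apply: contra_not Uy.
apply; rewrite (_ : z - y = (z - x) + (x - y))%R; last by rewrite addrA subrK.
by rewrite (le_lt_trans (ler_normD _ _))// -ltrBrDr distrC.
Qed.

Lemma bigcup_shrink U : open U -> \bigcup_n shrink U n = U.
Proof.
move=> oU; apply/seteqP; split => [x [n _]|x Ux].
  by apply; rewrite subrr normr0 invr_gt0.
have /nbhs_normP[d /= d0 dU] : nbhs x U by exact: open_nbhs_nbhs.
have [n nd] : exists n, (n.+1%:R^-1 < d)%R.
  by have [n] := ltr_add_invr d0; rewrite add0r => h; exists n.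
by exists n => // y xy; apply: dU; exact: lt_trans xy nd.
Qed.

Lemma shrink_nondecreasing U : nondecreasing_seq (shrink U).
Proof.
move=> n k nk; apply/subsetPset => x xn y xy; apply: xn.
by rewrite (lt_le_trans xy)// lef_pV2 ?posrE// ler_nat.
Qed.

(** U is the increasing union of the closed sets [shrink U n]; intersect a large
    one with a large compact set. *)
Lemma tight_inner_open mu (U : set X) (e : R) : tight mu -> open U -> (0 < e)%R ->
  exists C : set X, [/\ compact C, C `<=` U & mu U <= mu C + e%:E].
Proof.
move=> tmu oU e0.
have e20 : (0 < e / 2)%R by rewrite divr_gt0.
have [K cK Ke] := tmu _ e20.
have mF n : measurable (shrink U n : set (borel X)).
  by apply: closed_borel; exact: shrink_closed.
have mU := open_borel U oU.
have cv : mu (shrink U n) @[n --> \oo] --> mu U.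
  rewrite -[X in _ --> mu X](bigcup_shrink U oU); apply: nondecreasing_cvg_mu => //.
    by rewrite bigcup_shrink.
  exact: shrink_nondecreasing.
pose a := fine (mu U).
have aE : mu U = a%:E by rewrite fineK// fin_num_measure.
have [n hn] : exists n, (a - e / 2)%:E <= mu (shrink U n).
  apply: contrapT => /forallNP h.
  have : a%:E <= (a - e / 2)%:E.
    rewrite -aE -(cvg_lim _ cv)//; apply: lime_le; first by apply/cvg_ex; exists (mu U).
    by apply: nearW => n; rewrite ltW// ltNge; apply/negP/h.
  by rewrite lee_fin; lra.
exists (shrink U n `&` K); split.
- apply: (subclosed_compact _ cK); last exact: subIsetr.
  apply: closedI; first exact: shrink_closed.
  by apply: compact_closed => //; exact: norm_hausdorff.
- by apply: subset_trans (@subIsetl _ _ _) _; rewrite -[X in _ `<=` X](bigcup_shrink U oU); exact: bigcup_sup.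
- have h2 := prob_setIcompact mu (e / 2) _ _ (mF n) (compact_borel K cK) Ke.
  rewrite aE; apply: (@le_trans _ _ (mu (shrink U n) + (e / 2)%:E)).
    by rewrite -leeBlDr// -EFinB.
  apply: (@le_trans _ _ (mu (shrink U n `&` K) + (e / 2)%:E + (e / 2)%:E)).
    by rewrite leeD2r.
  by rewrite -addeA -EFinD -splitr.
Qed.

End tightness.

Arguments tight {R X} mu.
Arguments radon_tight {R X} mu.
Arguments prob_setIcompact {R X} mu e A K.
Arguments shrink {R X} U n.
Arguments bigcup_shrink {R X} U.
Arguments tight_inner_open {R X} mu U e.

Section tight_uniqueness.
Variables (R : realType) (X : normedModType R).
Local Open Scope ereal_scope.

(** Functionals separate points, so finitely many open half-spaces around x
    isolate it from the compact set D, and finitely many such polyhedra cover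
    the compact set C. *)
Lemma stable_separates (mu nu : probability (borel X) R) (C D : set X) :
  (forall (f : dual X) (c : R),
    \int[mu]_x (cos (f x + c))%:E = \int[nu]_x (cos (f x + c))%:E) ->
  compact C -> compact D -> C `&` D = set0 ->
  exists A, [/\ stable mu nu A, C `<=` A & A `&` D = set0].
Proof.
move=> cos_eq cC cD CD.
have s0 : stable mu nu set0.
  split; first exact: measurable0.
  move=> w mw; have [m _ _] := mw.
  have m0 := multiplier_lin (-1) _ _ mw mw.
  apply: multiplier_ext m0 => x.
  by rewrite indic0 mul0r mulN1r addNr.
pose Q (B : set X) := stable mu nu B /\ B `&` D = set0.
have [|||A CA [sA AD]] := @compact_ind X C Q cC.
- by split=> //; rewrite set0I.
- move=> A B [sA AD] [sB BD]; split; first exact: stableU.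
  by rewrite setIUl AD BD setU0.
- move=> x Cx.
  (* Avoiding a larger compact set costs further half-spaces around x. *)
  pose Q' (B : set X) := exists A, [/\ stable mu nu A, open A, A x & A `&` B = set0].
  have [|||B DB [A [sA oA Ax AB]]] := @compact_ind X D Q' cD.
  + exists setT; split => //; last by rewrite setI0.
      by rewrite -setC0; exact: stableC.
    exact: openT.
  + move=> A B [A' [sA oA Ax AA]] [B' [sB oB Bx BB]].
    exists (A' `&` B'); split => //; [exact: stableI|exact: openI|].
    rewrite setIUr -subset0 => y [[[Ay By] Aay]|[[Ay By] Bby]].
      by rewrite -AA.
    by rewrite -BB.
  + move=> y Dy.
    have [e exy] : exists e : dual X, (e y < e x)%R.
      apply: contrapT => /forallNP h.
      have xy : x = y.
        apply: dual_separates => e; apply/eqP; rewrite eq_le.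
        have -> : (e x <= e y)%R by rewrite leNgt; apply/negP/h.
        have [e' e'E] := dual_comb (-2) e e.
        have : ~ (e' y < e' x)%R by exact: h.
        by rewrite !e'E => /negP; rewrite -leNgt => ?; lra.
      have : (C `&` D) x by split => //; rewrite xy.
      by rewrite CD.
    pose a := ((e x + e y) / 2)%R.
    have /continuousP ec : continuous (e : X -> R) by exact: (@dual_continuous _ _ e).
    exists [set z | (e z < a)%R]; split.
    * exact: (ec _ (@open_lt R a)).
    * by rewrite /= /a; lra.
    * exists [set z | (a < e z)%R]; split.
      - exact: stable_halfspace.
      - exact: (ec _ (@open_gt R a)).
      - by rewrite /= /a; lra.
      - by rewrite -subset0 => z [/= h1 h2]; move: (lt_trans h1 h2); rewrite ltxx.
  exists A; split => //; split => //.
  by rewrite -subset0 -AB => z [Az Dz]; split => //; exact: DB.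
by exists A.
Qed.

(** For U open, take C compact in U with almost the same mu-measure, and
    separate it by a stable set A from a large compact part of the complement of
    U: then mu C <= mu A = nu A, which is at most nu U up to a small error. *)
Theorem tight_unique (mu nu : probability (borel X) R) :
  tight mu -> tight nu ->
  (forall (f : dual X) (c : R),
    \int[mu]_x (cos (f x + c))%:E = \int[nu]_x (cos (f x + c))%:E) ->
  forall B : set (borel X), measurable B -> mu B = nu B.
Proof.
have open_le (m n : probability (borel X) R) : tight m -> tight n ->
  (forall (f : dual X) (c : R),
    \int[m]_x (cos (f x + c))%:E = \int[n]_x (cos (f x + c))%:E) ->
  forall U : set X, open U -> m U <= n U.
  move: m n => {}mu {}nu.
  move=> tmu tnu cos_eq U oU; apply/lee_addgt0Pr => e e0.
  have e20 : (0 < e / 2)%R by rewrite divr_gt0.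
  have [C [cC CU Ce]] := tight_inner_open mu U _ tmu oU e20.
  have [K cK Ke] := tnu _ e20.
  have cN : closed (~` U) by exact: open_closedC.
  have cD : compact (~` U `&` K).
    apply: (subclosed_compact _ cK); last exact: subIsetr.
    by apply: closedI => //; apply: compact_closed => //; exact: norm_hausdorff.
  have CD : C `&` (~` U `&` K) = set0.
    by rewrite -subset0 => x [Cx [Ux _]]; apply: Ux; exact: CU.
  have [A [sA CA AD]] := stable_separates _ _ _ _ cos_eq cC cD CD.
  have mA : measurable (A : set (borel X)) by case: sA.
  have muU := open_borel U oU.
  apply: (le_trans Ce).
  have -> : e%:E = (e / 2)%:E + (e / 2)%:E by rewrite -EFinD -splitr.
  rewrite addeA leeD2r//.
  apply: (@le_trans _ _ (mu A)).
    by apply: le_measure => //; rewrite inE//; exact: compact_borel.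
  rewrite (stable_eq cos_eq A sA).
  have := prob_setIcompact nu (e / 2) A K mA (compact_borel K cK) Ke.
  move=> /le_trans; apply; rewrite leeD2r//.
  apply: le_measure; rewrite ?inE//.
    by apply: measurableI => //; exact: compact_borel.
  move=> x [Ax Kx]; apply: contrapT => Ux.
  have : (A `&` (~` U `&` K)) x by [].
  by rewrite AD.
move=> tmu tnu cos_eq B mB.
apply: (@measure_unique _ R (borel X) (@open X) (fun=> setT)) => //.
- by move=> A A' oA oA'; exact: openI.
- by move=> _; exact: openT.
- by rewrite bigcup_const//; exists 0%N.
- move=> U oU; apply/eqP; rewrite eq_le; apply/andP; split; first exact: open_le.
  by apply: open_le => // f c; rewrite cos_eq.
- by move=> _; rewrite (le_lt_trans (probability_le1 mu measurableT)) ?ltry.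
Qed.

Definition same_marginals (mu nu : probability (borel X) R) :=
  forall (f : dual X) (A : set (measurableTypeR R)), measurable A ->
    pushforward mu (f : borel X -> measurableTypeR R) A =
    pushforward nu (f : borel X -> measurableTypeR R) A.

Lemma same_marginals_integral (mu nu : probability (borel X) R) :
  same_marginals mu nu -> forall (f : dual X) (u : R -> R) C,
  measurable_fun setT u -> (forall t, (`|u t| <= C)%R) ->
  \int[mu]_x (u (f x))%:E = \int[nu]_x (u (f x))%:E.
Proof.
move=> mn f u C mu' uC.
have mf : measurable_fun setT (f : borel X -> measurableTypeR R).
  by apply: continuous_measurable_real; exact: (@dual_continuous _ _ f).
have E (P : probability (borel X) R) : \int[P]_x (u (f x))%:E =
    \int[pushforward P (f : borel X -> measurableTypeR R)]_t (u t)%:E.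
  rewrite integral_pushforward//=; first exact/measurable_EFinP.
  apply: (bounded_integrable P (u \o f) C).
    exact: measurableT_comp.
  by move=> x; exact: uC.
rewrite !E; apply: eq_measure_integral => A mA _; exact: mn.
Qed.

End tight_uniqueness.

Arguments tight_unique {R X mu nu}.
Arguments same_marginals {R X} mu nu.
Arguments same_marginals_integral {R X mu nu}.

(** * Normal laws: affine images and convolution *)

Section normal_affine.
Variable R : realType.
Local Open Scope ereal_scope.
Local Notation lambda := (@lebesgue_measure R).

Definition affine (a s : R) : measurableTypeR R -> measurableTypeR R := fun x => (a + s * x)%R.

Lemma measurable_affine a s : measurable_fun setT (affine a s).
Proof. by apply: measurable_funD => //; apply: measurable_funM. Qed.

Lemma lebesgue_affine (a s : R) (A : set (measurableTypeR R)) : (0 < s)%R -> measurable A ->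
  lambda A = s%:E * lambda (affine a s @^-1` A).
Proof.
move=> s0 mA.
pose m0 : {measure set (measurableTypeR R) -> \bar R} :=
  image_measure (measurable_affine a s) lambda.
pose m := mscale (NngNum (ltW s0)) m0.
rewrite (@lebesgue_measure_unique R m _ A mA) //= => _ [[c d]] _ <-.
rewrite /m /mscale /= /pushforward.
have -> : affine a s @^-1` `]c, d] = `]((c - a) / s)%R, ((d - a) / s)%R]%classic.
  apply/seteqP; split => x /=; rewrite !in_itv /= /affine ltr_pdivrMr// ler_pdivlMr//
    ltrBlDl lerBrDl mulrC//.
rewrite !lebesgue_measure_itv /= !lte_fin ltr_pM2r ?invr_gt0// ltrD2r.
case: ifPn => _; last by rewrite mule0.
by rewrite -!EFinB -EFinM; congr EFin; field; rewrite gt_eqF.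
Qed.

Lemma normal_pdf_affine (a s x : R) : (0 < s)%R ->
  (normal_pdf a s (a + s * x) = s^-1 * normal_pdf 0 1 x)%R.
Proof.
move=> s0; rewrite !normal_pdfE ?gt_eqF// /normal_peak /normal_fun.
rewrite mulrA; congr (_ * expR _)%R; last by field; rewrite gt_eqF.
rewrite expr1n mul1r -mulrnAr sqrtrM ?sqr_ge0// sqrtr_sqr gtr0_norm//.
by rewrite invfM.
Qed.

Lemma normal_affine (a s : R) (A : set (measurableTypeR R)) : (0 < s)%R -> measurable A ->
  normal_prob a s A = pushforward (normal_prob 0 1) (affine a s) A.
Proof.
move=> s0 mA; rewrite /pushforward /normal_prob.
have mA' : measurable (affine a s @^-1` A).
  by rewrite -[X in measurable X]setTI; exact: measurable_affine.
have mpdf b t : measurable_fun setT (fun x => (normal_pdf b t x)%:E : \bar R).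
  by apply/measurable_EFinP; exact: measurable_normal_pdf.
pose m0 : {measure set (measurableTypeR R) -> \bar R} :=
  image_measure (measurable_affine a s) lambda.
pose m := mscale (NngNum (ltW s0)) m0.
transitivity (\int[m]_(x in A) (normal_pdf a s x)%:E).
  by apply: eq_measure_integral => B mB _; exact: lebesgue_affine.
rewrite ge0_integral_mscale//=; last 2 first.
  by apply: measurable_funTS; exact: mpdf.
  by move=> x _; rewrite lee_fin normal_pdf_ge0.
rewrite ge0_integral_pushforward//; [|exact: measurable_affine|by apply: measurable_funTS; exact: mpdf|
  by move=> x _; rewrite lee_fin normal_pdf_ge0].
rewrite -ge0_integralZl//=.
- by apply: eq_integral => x _; rewrite -EFinM normal_pdf_affine// mulrA mulfV ?mul1r// gt_eqF.
- apply: measurable_funTS; apply/measurable_EFinP.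
  by apply: measurableT_comp; [exact: measurable_normal_pdf|exact: measurable_affine].
- by move=> x _; rewrite lee_fin normal_pdf_ge0.
- by rewrite lee_fin ltW.
Qed.

Lemma normal_shift (a b s : R) (A : set (measurableTypeR R)) : (0 < s)%R -> measurable A ->
  normal_prob (a + b) s A = normal_prob a s ((fun x => x + b)%R @^-1` A).
Proof.
move=> s0 mA.
have mA' : measurable ((fun x => x + b : measurableTypeR R)%R @^-1` A).
  by rewrite -[X in measurable X]setTI; exact: measurable_funD.
rewrite !normal_affine// /pushforward -comp_preimage; congr (normal_prob 0 1 (_ @^-1` A)).
by apply/funext => x; rewrite /affine /=; ring.
Qed.

End normal_affine.

Arguments affine {R} a s.
Arguments measurable_affine {R} a s.
Arguments normal_affine {R} a s A.
Arguments normal_shift {R} a b s A.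

Section normal_convolution.
Variable R : realType.
Local Open Scope ereal_scope.
Local Notation lambda := (@lebesgue_measure R).

Lemma integral_normal_prob (a s : R) (f : R -> \bar R) :
  (normal_prob a s).-integrable setT f ->
  \int[normal_prob a s]_x f x = \int[lambda]_x (f x * (normal_pdf a s x)%:E).
Proof.
move=> intf; have mf := measurable_int _ intf.
rewrite -(Radon_Nikodym_change_of_variables (normal_prob_dominates a s))//=.
apply: ae_eq_integral => //.
- apply: emeasurable_funM => //; apply: (measurable_int lambda).
  by apply: Radon_Nikodym_integrable; exact: normal_prob_dominates.
- apply: emeasurable_funM => //=; apply/measurable_EFinP; exact: measurable_normal_pdf.
- apply: ae_eqe_mul2l => /=.
  rewrite Radon_NikodymE//=; first exact: normal_prob_dominates.
  move=> dom; case: cid => /= h [h1 h2 h3].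
  apply: integral_ae_eq => //=.
  + by apply/measurable_EFinP; exact: measurable_normal_pdf.
  + by move=> E _ mE; rewrite -h3.
Qed.

Lemma normal_cst (a s : R) (r : \bar R) : \int[normal_prob a s]_x r = r.
Proof. exact: (integral_prob_cst (normal_prob a s)). Qed.

(** Completing the square: given z, the variable y is normal with mean
    (b / c)^2 z and standard deviation a b / c. *)
Lemma normal_pdf_mul (a b c y z : R) : (0 < a)%R -> (0 < b)%R -> (0 < c)%R ->
  (c ^+ 2 = a ^+ 2 + b ^+ 2)%R ->
  (normal_pdf y a z * normal_pdf 0 b y =
   normal_pdf 0 c z * normal_pdf (b ^+ 2 / c ^+ 2 * z) (a * b / c) y)%R.
Proof.
move=> a0 b0 c0 cE.
have d0 : (0 < a * b / c)%R by rewrite divr_gt0// mulr_gt0.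
have peakE (s : R) : (0 < s)%R -> normal_peak s = (s^-1 * (Num.sqrt (pi *+ 2))^-1)%R.
  by move=> s0; rewrite /normal_peak -mulrnAr sqrtrM ?sqr_ge0// sqrtr_sqr gtr0_norm// invfM.
rewrite !normal_pdfE ?gt_eqF// !peakE// /normal_fun.
rewrite mulrACA [RHS]mulrACA -!expRD; congr (_ * expR _)%R.
  by field; rewrite !gt_eqF// sqrtr_gt0 pmulrn_lgt0// pi_gt0.
have -> : ((a * b / c) ^+ 2 = a ^+ 2 * b ^+ 2 / c ^+ 2)%R by rewrite !exprMn exprVn.
rewrite cE; field; rewrite !gt_eqF// addr_gt0// exprn_gt0//.
Qed.

(** The inner integral is one against N(y, a); exchanging the order of
    integration, the completed square integrates to 1 in y. *)
Lemma normal_convolution (a b c : R) (u : R -> R) (C : R) :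
  (0 < a)%R -> (0 < b)%R -> (0 < c)%R -> (c ^+ 2 = a ^+ 2 + b ^+ 2)%R ->
  measurable_fun setT u -> (forall t, (0 <= u t <= C)%R) ->
  \int[normal_prob 0 b]_y \int[normal_prob 0 a]_x (u (x + y))%:E =
  \int[normal_prob 0 c]_z (u z)%:E.
Proof.
move=> a0 b0 c0 cE mu uC.
have u0 t : (0 <= u t)%R by case/andP: (uC t).
have ub t : (`|u t| <= C)%R by rewrite ger0_norm//; case/andP: (uC t).
have mue : measurable_fun setT (fun z => (u z)%:E) by exact/measurable_EFinP.
have iu m s : (normal_prob m s).-integrable setT (fun z => (u z)%:E).
  exact: (bounded_integrable (normal_prob m s) u C mu ub).
pose g (p : R * R) : \bar R := ((u p.2)%:E * (normal_pdf p.1 a p.2)%:E).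
have mg : measurable_fun setT g.
  apply: emeasurable_funM; apply/measurable_EFinP.
    exact: measurableT_comp.
  under eq_fun do rewrite normal_pdfE ?gt_eqF//.
  apply: measurable_funM => //; apply: measurableT_comp => //.
  apply: measurable_funM => //; apply: measurableT_comp => //.
  by apply: measurable_funX; apply: measurable_funB => //.
have g0 p : 0 <= g p by rewrite mule_ge0// lee_fin// normal_pdf_ge0.
pose G y := \int[lambda]_z g (y, z).
have mG : measurable_fun setT G by exact: measurable_fun_fubini_tonelli_F.
have GE y : \int[normal_prob 0 a]_x (u (x + y))%:E = G y.
  have my : measurable_fun setT (fun x : measurableTypeR R => x + y : measurableTypeR R)%R.
    exact: measurable_funD.
  transitivity (\int[normal_prob y a]_z (u z)%:E); last first.
    exact: (integral_normal_prob y a _ (iu y a)).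
  transitivity (\int[image_measure my (normal_prob 0 a)]_z (u z)%:E).
    apply/esym; apply: (ge0_integral_pushforward my (normal_prob 0 a) measurableT mue).
    by move=> z _; rewrite lee_fin.
  apply: eq_measure_integral => A mA _.
  by rewrite -[in RHS](add0r y); apply/esym; exact: normal_shift.
have G0 y : 0 <= G y by apply: integral_ge0 => z _.
have GC y : G y <= C%:E.
  rewrite -GE.
  apply: (@le_trans _ _ (\int[normal_prob 0 a]_x (cst C%:E x))).
    apply: ge0_le_integral => //.
    - by move=> x _; rewrite lee_fin.
    - apply/measurable_EFinP; apply: measurableT_comp => //; exact: measurable_funD.
    - by move=> x _; rewrite /= lee_fin; case/andP: (uC (x + y)%R).
  by rewrite normal_cst.
have iG : (normal_prob 0 b).-integrable setT G.
  apply/integrableP; split => //.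
  apply: (@le_lt_trans _ _ (\int[normal_prob 0 b]_x (cst C%:E x))).
    apply: ge0_le_integral => //.
    - exact: measurableT_comp.
    - by move=> x _; rewrite gee0_abs.
  by rewrite normal_cst ltry.
under eq_integral do rewrite GE.
rewrite [LHS](integral_normal_prob 0 b G iG).
pose h (p : R * R) : \bar R := g p * (normal_pdf 0 b p.1)%:E.
have mh : measurable_fun setT h.
  apply: emeasurable_funM => //; apply/measurable_EFinP; apply: measurableT_comp => //.
  exact: measurable_normal_pdf.
have h0 p : 0 <= h p by rewrite mule_ge0// lee_fin normal_pdf_ge0.
transitivity (\int[lambda]_y \int[lambda]_z h (y, z)).
  apply: eq_integral => y _; rewrite /h /=.
  rewrite ge0_integralZr//; first by apply: measurableT_comp => //; exact: measurable_pair1.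
  by rewrite lee_fin normal_pdf_ge0.
transitivity (\int[lambda]_z \int[lambda]_y h (y, z)); first exact: fubini_tonelli.
rewrite [RHS](integral_normal_prob 0 c _ (iu 0%R c)); apply: eq_integral => z _.
transitivity (\int[lambda]_y (((u z)%:E * (normal_pdf 0 c z)%:E) *
    (normal_pdf (b ^+ 2 / c ^+ 2 * z)%R (a * b / c)%R y)%:E)).
  apply: eq_integral => y _; rewrite /h /g /= -!muleA; congr (_ * _).
  by rewrite -!EFinM (normal_pdf_mul a b c).
rewrite ge0_integralZl//.
- by rewrite integral_normal_pdf mule1.
- by apply/measurable_EFinP; exact: measurable_normal_pdf.
- by move=> y _; rewrite lee_fin normal_pdf_ge0.
- by rewrite mule_ge0// lee_fin ?u0 ?normal_pdf_ge0.
Qed.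

End normal_convolution.

Arguments normal_cst {R} a s r.
Arguments normal_convolution {R a b c u C}.

(** * Gaussian random variables: moments, uniqueness, sums *)

Section gauss_law.
Variable R : realType.
Local Open Scope ereal_scope.
Local Notation lambda := (@lebesgue_measure R).
Local Notation N01 := (normal_prob (0 : R) 1).

(** Images of the standard normal law treat Dirac masses (s = 0) and
    nondegenerate laws at once, which [real_gaussian] distinguishes. *)
Definition gauss_law (a s : R) (nu : set (measurableTypeR R) -> \bar R) :=
  (0 <= s)%R /\ forall A, measurable A -> nu A = N01 (affine a s @^-1` A).

Lemma dirac_affine (a : R) (A : set (measurableTypeR R)) :
  \d_a A = N01 (affine a 0 @^-1` A).
Proof.
have -> : affine a 0 = cst a by apply/funext => x; rewrite /affine mul0r addr0.
by rewrite preimage_cst diracE; case: ifPn => _; rewrite ?probability_setT ?measure0.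
Qed.

Lemma real_gaussianP (nu : set (measurableTypeR R) -> \bar R) :
  real_gaussian nu <-> exists a s, gauss_law a s nu.
Proof.
split => [[[a nuE]|[a [s [s0 nuE]]]]|[a [s [s0 nuE]]]].
- by exists a, 0%R; split => // A mA; rewrite nuE// dirac_affine.
- by exists a, s; split => [|A mA]; [exact: ltW|rewrite (nuE _ mA); exact: (normal_affine a s A s0 mA)].
- move: s0; rewrite le_eqVlt => /predU1P[s0|s0].
    by left; exists a => A mA; rewrite nuE// -s0 dirac_affine.
  right; exists a, s; split; first exact: s0.
  by move=> A mA; rewrite (nuE _ mA); apply/esym; exact: (normal_affine a s A s0 mA).
Qed.

Lemma gauss_law_shift a s b (nu : set (measurableTypeR R) -> \bar R) :
  gauss_law a s nu -> gauss_law (a + b) s (fun A => nu ((fun x => x + b)%R @^-1` A)).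
Proof.
move=> [s0 nuE]; split => // A mA; rewrite nuE; last first.
  by rewrite -[X in measurable X]setTI; exact: measurable_funD.
rewrite -comp_preimage; congr (N01 (_ @^-1` A)).
by apply/funext => x; rewrite /affine /=; ring.
Qed.

Lemma normal01N (A : set (measurableTypeR R)) : measurable A ->
  N01 (-%R @^-1` A) = N01 A.
Proof.
move=> mA; rewrite /normal_prob.
have mN : measurable_fun setT (-%R : measurableTypeR R -> measurableTypeR R) by [].
have mpdf : measurable_fun setT (fun x => (normal_pdf 0 1 x)%:E : \bar R).
  by apply/measurable_EFinP; exact: measurable_normal_pdf.
transitivity (\int[image_measure mN lambda]_(x in A) (normal_pdf 0 1 x)%:E); last first.
  by apply: eq_measure_integral => B mB _; exact: lebesgue_measureN.
have mpdfA := measurable_funTS (D := A) mpdf.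
rewrite [RHS](ge0_integral_pushforward mN lambda mA mpdfA).
- apply: eq_integral => x _; congr EFin => /=.
  by rewrite !normal_pdfE ?oner_neq0// /normal_fun !subr0 sqrrN.
- by move=> x _; rewrite lee_fin normal_pdf_ge0.
Qed.

(** A common positive factor of all the variances that are to be compared. *)
Definition normal_var : R := fine (\int[N01]_x (x ^+ 2)%:E).

(** By symmetry of the normal law. *)
Lemma normal01_mean : N01.-integrable setT (fun x => x%:E) -> \int[N01]_x x%:E = 0.
Proof.
move=> ix.
have mN : measurable_fun setT (-%R : measurableTypeR R -> measurableTypeR R) by [].
have E : \int[N01]_x x%:E = - \int[N01]_x x%:E.
  transitivity (\int[image_measure mN N01]_x x%:E).
    by apply: eq_measure_integral => A mA _; rewrite -[LHS]normal01N.
  rewrite integral_pushforward//= ?preimage_setT.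
    by under eq_integral do rewrite -mulN1r EFinM; rewrite integralZl// EFinN mulN1e.
  by apply: eq_integrable (integrableN ix).
have f : \int[N01]_x x%:E \is a fin_num by exact: integrable_fin_num.
move: E; rewrite -(fineK f) -EFinN => -[h]; congr EFin; lra.
Qed.

(** Otherwise the law would be carried by the Lebesgue null set {0}. *)
Lemma normal01_var_gt0 : 0 < \int[N01]_x (x ^+ 2)%:E.
Proof.
rewrite lt0e; apply/andP; split; last by apply: integral_ge0 => x _; rewrite lee_fin sqr_ge0.
apply/negP => /eqP I0.
have m2 : measurable_fun setT (fun x : measurableTypeR R => (x ^+ 2)%:E).
  by apply/measurable_EFinP.
have I0' : \int[N01]_x `|(x ^+ 2)%:E| = 0.
  by rewrite -[RHS]I0; apply: eq_integral => x _; rewrite gee0_abs// lee_fin sqr_ge0.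
have [N [mN N0 sN]] := proj1 (ae_eq_integral_abs N01 measurableT m2) I0'.
have : N01 (setT : set (measurableTypeR R)) <= 0.
  have Z0 : N01 [set 0%R] = 0.
    have /null_content_dominatesP := normal_prob_dominates (0 : R) 1.
    by apply => //; exact: lebesgue_measure_set1.
  rewrite -[leRHS](adde0 0) -{1}N0 -Z0.
  apply: (@le_trans _ _ (N01 (N `|` [set 0%R]))); last exact: measureU2.
  apply: le_measure; rewrite ?inE//; first exact: measurableU.
  move=> x _; have [->|x0] := eqVneq x 0%R; first by right.
  left; apply: sN => /= h; have := h I => -[] /eqP.
  by rewrite sqrf_eq0 (negbTE x0).
by rewrite probability_setT lee_fin ler10.
Qed.

End gauss_law.

Arguments gauss_law {R} a s nu.
Arguments gauss_law_shift {R a s} b {nu}.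

Section moments.
Context d (T : measurableType d) (R : realType) (P : probability T R).
Variables (f : T -> measurableTypeR R) (mf : measurable_fun setT f).
Variables (a s : R).
Hypothesis fas : gauss_law a s (pushforward P f).
Local Open Scope ereal_scope.
Local Notation N01 := (normal_prob (0 : R) 1).

Lemma gauss_ge0_integral (u : R -> \bar R) : measurable_fun setT u ->
  (forall t, 0 <= u t) -> \int[P]_x u (f x) = \int[N01]_x u (a + s * x)%R.
Proof.
move=> mu u0.
transitivity (\int[pushforward P f]_x u x); first by rewrite ge0_integral_pushforward.
transitivity (\int[image_measure (measurable_affine a s) N01]_x u x).
  by apply: eq_measure_integral => A mA _; case: fas => _ h; exact: h.
by rewrite ge0_integral_pushforward//; exact: measurable_affine.
Qed.

Lemma gauss_integrable (u : R -> \bar R) : measurable_fun setT u ->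
  P.-integrable setT (u \o f) -> N01.-integrable setT (fun x => u (a + s * x)%R).
Proof.
move=> mu /integrableP[_ iu]; apply/integrableP; split.
  apply: measurableT_comp => //; exact: measurable_affine.
rewrite -(gauss_ge0_integral (fun t => `|u t|))//.
exact: measurableT_comp.
Qed.

Lemma gauss_integral (u : R -> \bar R) : measurable_fun setT u ->
  P.-integrable setT (u \o f) -> \int[P]_x u (f x) = \int[N01]_x u (a + s * x)%R.
Proof.
move=> mu iu.
transitivity (\int[pushforward P f]_x u x); first by rewrite integral_pushforward.
transitivity (\int[image_measure (measurable_affine a s) N01]_x u x).
  by apply: eq_measure_integral => A mA _; case: fas => _ h; exact: h.
rewrite integral_pushforward//; first exact: measurable_affine.
by exact: gauss_integrable.
Qed.

Lemma sqr_integrable (h : T -> R) : measurable_fun setT h ->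
  P.-integrable setT (fun x => (h x ^+ 2)%:E) -> P.-integrable setT (fun x => (h x)%:E).
Proof.
move=> mh ih.
apply: (@le_integrable _ _ _ P _ measurableT _ (fun x => 1 + (h x ^+ 2)%:E)).
- exact/measurable_EFinP.
- move=> x _; rewrite -EFinD !abse_EFin lee_fin [leRHS]ger0_norm; last by rewrite addr_ge0// sqr_ge0.
  by rewrite ler_norml; apply/andP; split; nra.
- by apply: integrableD => //; exact: finite_measure_integrable_cst.
Qed.

Lemma gauss_moments : P.-integrable setT (fun x => (f x ^+ 2)%:E) ->
  [/\ \int[P]_x (f x)%:E = a%:E,
      \int[P]_x (f x ^+ 2)%:E = (a ^+ 2 + s ^+ 2 * normal_var R)%:E &
      (0 < s)%R -> (0 < normal_var R)%R].
Proof.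
move=> if2; have if1 := sqr_integrable f mf if2.
have m1 : measurable_fun setT (fun t : measurableTypeR R => t%:E) by exact/measurable_EFinP.
have m2 : measurable_fun setT (fun t : measurableTypeR R => (t ^+ 2)%:E).
  by apply/measurable_EFinP; exact: measurable_funX.
rewrite (gauss_integral (fun t => t%:E))// (gauss_integral (fun t => (t ^+ 2)%:E))//.
have ia2 := gauss_integrable (fun t => (t ^+ 2)%:E) m2 if2.
have [s0 _] := fas; move: s0; rewrite le_eqVlt => /predU1P[s0|s0].
  rewrite -s0 ltxx expr0n mul0r addr0; split => //.
    under eq_integral do rewrite mul0r addr0.
    by rewrite normal_cst.
  under eq_integral do rewrite mul0r addr0.
  by rewrite normal_cst.
have i2 : N01.-integrable setT (fun x => (x ^+ 2)%:E).
  apply: (@le_integrable _ _ _ N01 _ measurableT _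
    (fun x => (2 / s ^+ 2)%:E * (((a + s * x) ^+ 2)%:E + (a ^+ 2)%:E))) => //.
    move=> x _; rewrite -EFinD -EFinM !abse_EFin lee_fin !ger0_norm ?sqr_ge0//; last first.
      by rewrite mulr_ge0 ?divr_ge0 ?addr_ge0 ?sqr_ge0.
    rewrite -mulrAC ler_pdivlMr ?exprn_gt0//.
    have := sqr_ge0 (2 * a + s * x)%R; nra.
  apply: integrableZl => //; apply: integrableD => //; exact: finite_measure_integrable_cst.
have i1 : N01.-integrable setT (fun x => x%:E).
  have [mu _] := integrableP _ _ _ i2.
  apply: (@le_integrable _ _ _ N01 _ measurableT _ (fun x => 1 + (x ^+ 2)%:E)) => //.
    move=> x _; rewrite -EFinD !abse_EFin lee_fin [leRHS]ger0_norm; last by rewrite addr_ge0// sqr_ge0.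
    by rewrite ler_norml; apply/andP; split; nra.
  by apply: integrableD => //; exact: finite_measure_integrable_cst.
have i0 r : N01.-integrable setT (fun=> r%:E) by exact: finite_measure_integrable_cst.
have vE : \int[N01]_x (x ^+ 2)%:E = (normal_var R)%:E.
  by rewrite /normal_var fineK//; exact: integrable_fin_num.
have mean0 := normal01_mean R i1.
split.
- under eq_integral do rewrite EFinD EFinM.
  rewrite (@integralD _ _ _ N01 _ measurableT _ (fun x => s%:E * x%:E) (i0 a) (integrableZl measurableT s i1)).
  by rewrite normal_cst integralZl// mean0 mule0 adde0.
- have E x : ((a + s * x) ^+ 2)%:E = (a ^+ 2)%:E + ((2 * a * s)%:E * x%:E + (s ^+ 2)%:E * (x ^+ 2)%:E).
    by rewrite -!EFinM -!EFinD; congr EFin; ring.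
  under eq_integral do rewrite E.
  have j1 := integrableZl measurableT (2 * a * s)%R i1.
  have j2 := integrableZl measurableT (s ^+ 2)%R i2.
  rewrite (integralD measurableT (i0 _) (integrableD measurableT j1 j2)) (integralD measurableT j1 j2).
  rewrite normal_cst !integralZl// mean0 mule0 add0e vE.
  by rewrite -EFinM -EFinD.
- by move=> _; rewrite -lte_fin -vE normal01_var_gt0.
Qed.

End moments.

Arguments sqr_integrable {d T R P h}.
Arguments gauss_moments {d T R P f} mf {a s}.
Arguments gauss_ge0_integral {d T R P f} mf {a s} fas u.

Section gauss_comparison.
Variable R : realType.
Local Open Scope ereal_scope.
Local Notation N01 := (normal_prob (0 : R) 1).

(** A Gaussian law on the line is determined by its first two moments. *)
Lemma gauss_law_unique d (T : measurableType d) (P Q : probability T R)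
    (f : T -> measurableTypeR R) (mf : measurable_fun setT f) :
  real_gaussian (pushforward P f) -> real_gaussian (pushforward Q f) ->
  P.-integrable setT (fun x => (f x ^+ 2)%:E) ->
  Q.-integrable setT (fun x => (f x ^+ 2)%:E) ->
  \int[P]_x (f x)%:E = \int[Q]_x (f x)%:E ->
  \int[P]_x (f x ^+ 2)%:E = \int[Q]_x (f x ^+ 2)%:E ->
  forall A, measurable A -> pushforward P f A = pushforward Q f A.
Proof.
move=> /real_gaussianP[a [s Pf]] /real_gaussianP[b [t Qf]] iP iQ.
have [-> -> vs] := gauss_moments mf Pf iP.
have [-> -> vt] := gauss_moments mf Qf iQ.
move=> [ab]; rewrite -ab => -[/addrI st].
have [s0 PE] := Pf; have [t0 QE] := Qf.
suff st' : s = t by move=> A mA; rewrite PE// QE// st' ab.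
move: (s0) (t0); rewrite !le_eqVlt => /predU1P[s00|s00] /predU1P[t00|t00].
- by rewrite -s00 -t00.
- apply/eqP; rewrite -(@eqrXn2 _ 2)//; apply/eqP; apply: mulIf st.
  by rewrite gt_eqF// vt.
- apply/eqP; rewrite -(@eqrXn2 _ 2)//; apply/eqP; apply: mulIf st.
  by rewrite gt_eqF// vs.
- apply/eqP; rewrite -(@eqrXn2 _ 2)//; apply/eqP; apply: mulIf st.
  by rewrite gt_eqF// vt.
Qed.

Lemma normal01_convolution (a b c : R) (u : R -> R) (C : R) :
  (0 <= a)%R -> (0 <= b)%R -> (0 <= c)%R -> (c ^+ 2 = a ^+ 2 + b ^+ 2)%R ->
  measurable_fun setT u -> (forall t, (0 <= u t <= C)%R) ->
  \int[N01]_y \int[N01]_x (u (a * x + b * y))%:E = \int[N01]_z (u (c * z))%:E.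
Proof.
move=> a0 b0 c0 cE mu uC.
move: (a0); rewrite le_eqVlt => /predU1P[a00|a1].
  have -> : c = b.
    by apply/eqP; rewrite -(@eqrXn2 _ 2)// cE -a00 expr0n /= add0r.
  apply: eq_integral => y _; rewrite -[RHS](normal_cst 0 1).
  by apply: eq_integral => x _; rewrite -a00 mul0r add0r.
move: (b0); rewrite le_eqVlt => /predU1P[b00|b1].
  have -> : c = a.
    by apply/eqP; rewrite -(@eqrXn2 _ 2)// cE -b00 expr0n /= addr0.
  rewrite -[RHS](normal_cst 0 1); apply: eq_integral => y _.
  by apply: eq_integral => x _; rewrite -b00 mul0r addr0.
have c1 : (0 < c)%R.
  rewrite lt0r c0 andbT; apply/eqP => c00; move: cE; rewrite c00 expr0n /= => /esym/eqP.
  by rewrite gt_eqF// addr_gt0// exprn_gt0.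
have law (s : R) : (0 < s)%R -> gauss_law 0 s (pushforward (normal_prob 0 s) id).
  by move=> s0; split => [|A mA]; [exact: ltW|exact: normal_affine].
have tr (s : R) (w : R -> R) : (0 < s)%R -> measurable_fun setT w -> (forall t, (0 <= w t)%R) ->
  \int[N01]_x (w (s * x))%:E = \int[normal_prob 0 s]_x (w x)%:E.
  move=> s0 mw w0.
  have mI : measurable_fun setT (@id (measurableTypeR R)) by exact: measurable_id.
  have mwe : measurable_fun setT (fun x : measurableTypeR R => (w x)%:E) by exact/measurable_EFinP.
  rewrite [RHS](@gauss_ge0_integral _ _ _ (normal_prob 0 s) id mI 0 s (law s s0) _ mwe) => [|t].
    by apply: eq_integral => x _; rewrite add0r.
  by rewrite lee_fin.
have u0 t : (0 <= u t)%R by case/andP: (uC t).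
rewrite [RHS](tr c u c1 mu u0).
rewrite -[RHS](normal_convolution a1 b1 c1 cE mu uC).
have mshift t : measurable_fun setT (fun x : measurableTypeR R => u (x + t)%R).
  by apply: measurableT_comp; [exact: mu|exact: measurable_funD].
transitivity (\int[N01]_y \int[normal_prob 0 a]_x (u (x + b * y))%:E).
  apply: eq_integral => y _.
  exact: (tr a (fun x => u (x + b * y)%R) a1 (mshift _) (fun t => u0 _)).
pose G y := \int[normal_prob 0 a]_x (u (x + y))%:E.
have mG : measurable_fun setT G.
  apply: (@measurable_fun_fubini_tonelli_F _ _ _ _ R (normal_prob 0 a) (fun p : R * R => (u (p.2 + p.1))%:E)).
    apply/measurable_EFinP; apply: measurableT_comp; [exact: mu|exact: measurable_funD].
  by move=> p; rewrite lee_fin.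
have G0 y : 0 <= G y by apply: integral_ge0 => x _; rewrite lee_fin.
rewrite -[LHS]/(\int[N01]_y G (b * y)%R).
have mI : measurable_fun setT (@id (measurableTypeR R)) by exact: measurable_id.
rewrite [RHS](@gauss_ge0_integral _ _ _ (normal_prob 0 b) id mI 0 b (law b b1) G mG G0).
by apply: eq_integral => y _; rewrite add0r.
Qed.

(** Uncorrelated jointly Gaussian variables behave as if independent: the laws
    of f, g and f + g are centred normal and their variances add up, so the
    convolution of the first two is the third. *)
Lemma gauss_convolution d (T : measurableType d) (P : probability T R)
    (f g h : T -> measurableTypeR R) (u : R -> R) (C : R) :
  measurable_fun setT f -> measurable_fun setT g -> measurable_fun setT h ->
  real_gaussian (pushforward P f) -> real_gaussian (pushforward P g) ->
  real_gaussian (pushforward P h) ->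
  (forall x, h x = f x + g x)%R ->
  P.-integrable setT (fun x => (f x ^+ 2)%:E) ->
  P.-integrable setT (fun x => (g x ^+ 2)%:E) ->
  P.-integrable setT (fun x => (f x * g x)%:E) ->
  \int[P]_x (f x)%:E = 0 -> \int[P]_x (g x)%:E = 0 ->
  \int[P]_x (f x * g x)%:E = 0 ->
  measurable_fun setT u -> (forall t, (0 <= u t <= C)%R) ->
  \int[P]_y \int[P]_x (u (f x + g y))%:E = \int[P]_x (u (h x))%:E.
Proof.
move=> mf mg mh /real_gaussianP[a [s Pf]] /real_gaussianP[b [t Pg]].
move=> /real_gaussianP[c [r Ph]] hE if2 ig2 ifg Ef Eg Efg mu uC.
have E2 x : (h x ^+ 2)%:E = (f x ^+ 2)%:E + ((g x ^+ 2)%:E + 2%:E * (f x * g x)%:E).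
  by rewrite -EFinM -!EFinD hE; congr EFin; ring.
have i2fg := integrableZl measurableT 2%R ifg.
have ih2 : P.-integrable setT (fun x => (h x ^+ 2)%:E).
  under eq_fun do rewrite E2.
  by apply: integrableD => //; apply: integrableD.
have if1 := sqr_integrable mf if2.
have ig1 := sqr_integrable mg ig2.
have Eh : \int[P]_x (h x)%:E = 0.
  under eq_integral do rewrite hE EFinD.
  by rewrite integralD// Ef Eg adde0.
have Eh2 : \int[P]_x (h x ^+ 2)%:E = \int[P]_x (f x ^+ 2)%:E + \int[P]_x (g x ^+ 2)%:E.
  under eq_integral do rewrite E2.
  rewrite (integralD measurableT if2 (integrableD measurableT ig2 i2fg)).
  by rewrite (integralD measurableT ig2 i2fg) integralZl// Efg mule0 adde0.
have [] := gauss_moments mf Pf if2; rewrite Ef => -[a0] vf ps.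
have [] := gauss_moments mg Pg ig2; rewrite Eg => -[b0] vg pt.
have [] := gauss_moments mh Ph ih2; rewrite Eh => -[c0] vh pr.
subst a b c.
move: Eh2; rewrite vf vg vh -EFinD => -[]; rewrite !expr0n /= !add0r -mulrDl => var.
have [s0 _] := Pf; have [t0 _] := Pg; have [r0 _] := Ph.
have cE : (r ^+ 2 = s ^+ 2 + t ^+ 2)%R.
  (* Positivity of normal_var is known once one of the laws is nondegenerate; otherwise all deviations vanish. *)
  have [v0|v0] := ltP 0%R (normal_var R); first by apply: mulIf var; rewrite gt_eqF.
  have nz (z : R) : (0 <= z)%R -> ((0 < z)%R -> (0 < normal_var R)%R) -> z = 0%R.
    move=> z0 zp; apply/eqP; rewrite eq_le z0 andbT leNgt; apply/negP => /zp.
    by rewrite ltNge v0.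
  by rewrite (nz s)// (nz t)// (nz r)// expr0n addr0.
have u0 z : (0 <= u z)%R by case/andP: (uC z).
have mue : measurable_fun setT (fun z : measurableTypeR R => (u z)%:E) by exact/measurable_EFinP.
have mut z : measurable_fun setT (fun x : measurableTypeR R => (u (x + z))%:E).
  apply/measurable_EFinP; apply: measurableT_comp => //; exact: measurable_funD.
have ue0 z : 0 <= (u z)%:E by rewrite lee_fin.
transitivity (\int[N01]_y \int[N01]_x (u (s * x + t * y))%:E); last first.
  rewrite [LHS](normal01_convolution s t r u C s0 t0 r0 cE mu uC).
  rewrite [RHS](gauss_ge0_integral mh Ph (fun z => (u z)%:E) mue ue0).
  by apply: eq_integral => x _; rewrite add0r.
pose G y := \int[N01]_x (u (s * x + y))%:E.
have mG : measurable_fun setT G.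
  apply: (@measurable_fun_fubini_tonelli_F _ _ _ _ R N01 (fun p : R * R => (u (s * p.2 + p.1))%:E)).
    apply/measurable_EFinP; apply: measurableT_comp; first exact: mu.
    by apply: measurable_funD => //; apply: measurable_funM.
  by move=> p; rewrite lee_fin.
have G0 y : 0 <= G y by apply: integral_ge0 => x _; rewrite lee_fin.
transitivity (\int[P]_y G (g y)).
  apply: eq_integral => y _.
  rewrite [LHS](gauss_ge0_integral mf Pf (fun z => (u (z + g y))%:E) (mut _) (fun z => ue0 _)).
  by apply: eq_integral => x _; rewrite add0r.
rewrite [LHS](gauss_ge0_integral mg Pg G mG G0).
by apply: eq_integral => y _; rewrite add0r.
Qed.

End gauss_comparison.

Arguments gauss_law_unique {R d T P Q f}.
Arguments gauss_convolution {R d T P f g h u C}.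

(** * Approximation from a dense subset and Lipschitz extension *)

Section approximation.
Variable R : realType.

Lemma closure_approx (V : normedModType R) (D : set V) y e :
  closure D y -> 0 < e -> exists2 z, D z & `|y - z| < e.
Proof.
move=> Dy e0.
have /Dy[z [Dz yz]] : nbhs y [set z | `|y - z| < e] by apply/nbhs_normP; exists e.
by exists z.
Qed.

(** One point z serves for both approximations; this is how identities are
    carried from a set to its closure. *)
Lemma within_closure_approx (V W : normedModType R) (D : set V) (f : V -> W) y e :
  {within closure D, continuous f} -> closure D y -> 0 < e ->
  exists z, [/\ D z, `|y - z| < e & `|f y - f z| < e].
Proof.
move=> /subspace_continuousP fc Dy e0.
have /cvgrPdist_lt/(_ e e0) fy := fc y Dy.
have ny : nbhs y [set z | `|y - z| < e] by apply/nbhs_normP; exists e.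
have /Dy[z [Dz [fz yz]]] : nbhs y ([set z | closure D z -> `|f y - f z| < e]
    `&` [set z | `|y - z| < e]) by exact: filterI.
by exists z; split => //; apply: fz; exact: subset_closure.
Qed.

Lemma ler_eps (x y N : R) : (forall e, 0 < e -> x <= y + N * e) -> x <= y.
Proof.
move=> h; apply/ler_addgt0Pr => e e0.
have N0 : 0 < `|N| + 1 by rewrite ltr_wpDl.
apply: (le_trans (h (e / (`|N| + 1)) _)); first by rewrite divr_gt0.
rewrite lerD2l mulrA ler_pdivrMr// mulrC ler_wpM2l ?(ltW e0)//.
by rewrite (le_trans (ler_norm _))// lerDl.
Qed.

Lemma norm0_eps (V : normedModType R) (v : V) N :
  (forall e, 0 < e -> `|v| <= N * e) -> v = 0.
Proof.
move=> h; apply/eqP; rewrite -normr_le0; apply: (ler_eps _ _ N) => e e0.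
by rewrite add0r h.
Qed.

Lemma lipschitz_within (V W : normedModType R) (D : set V) (f : V -> W) C :
  0 <= C -> (forall y z, D y -> D z -> `|f y - f z| <= C * `|y - z|) ->
  {within D, continuous f}.
Proof.
move=> C0 fC; apply/subspace_continuousP => y Dy; apply/cvgrPdist_lt => e e0.
have C1 : 0 < C + 1 by rewrite ltr_wpDl.
apply/nbhs_normP; exists (e / (C + 1)) => /=; first by rewrite divr_gt0.
move=> z yz Dz; rewrite (le_lt_trans (fC _ _ Dy Dz))//.
rewrite (@le_lt_trans _ _ ((C + 1) * `|y - z|))//; first by rewrite ler_wpM2r// lerDl.
by rewrite mulrC -ltr_pdivlMr.
Qed.

(** The value at y is the limit of f along D near y, a Cauchy filter. *)
Lemma lipschitz_extension (V : normedModType R) (W : completeNormedModType R)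
    (D : set V) (f : V -> W) C :
  0 <= C -> (forall y z, D y -> D z -> `|f y - f z| <= C * `|y - z|) ->
  exists2 m : V -> W, {within closure D, continuous m} & forall y, D y -> m y = f y.
Proof.
move=> C0 fC.
pose F (y : V) := f @ within D (nbhs y).
have FP y : closure D y -> ProperFilter (F y).
  by move=> Dy; apply: fmap_proper_filter; exact: within_nbhs_proper.
have C1 : 0 < C + 1 by rewrite ltr_wpDl.
have Fcvg y : closure D y -> cvg (F y).
  move=> Dy; have FPy := FP y Dy; apply: cauchy_cvg; apply: cauchy_exP => e e0.
  have e2 : 0 < e / (C + 1) / 2 by rewrite !divr_gt0.
  have [z Dz yz] := closure_approx _ _ _ _ Dy e2.
  exists (f z); rewrite /F /=; apply/nbhs_normP; exists (e / (C + 1) / 2) => //= t yt Dt.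
  rewrite -ball_normE /= (le_lt_trans (fC _ _ Dz Dt))//.
  rewrite (@le_lt_trans _ _ ((C + 1) * `|z - t|))//; first by rewrite ler_wpM2r// lerDl.
  rewrite mulrC -ltr_pdivlMr// (splitr (e / (C + 1))).
  rewrite (_ : z - t = (z - y) + (y - t)); last by rewrite addrA subrK.
  by rewrite (le_lt_trans (ler_normD _ _))// ltrD// distrC.
pose m y := lim (F y).
have mF y : closure D y -> F y --> m y by move=> /Fcvg.
have mf y : D y -> m y = f y.
  move=> Dy; have cDy := subset_closure Dy; have FPy := FP y cDy.
  apply: cvg_lim; first exact: norm_hausdorff.
  have /subspace_continuousP := lipschitz_within _ _ D f C C0 fC.
  by apply.
have approx y e : closure D y -> 0 < e ->
    exists z, [/\ D z, `|y - z| < e & `|m y - f z| < e].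
  move=> Dy e0; have FPy := FP y Dy.
  have /cvgrPdist_lt/(_ e e0) fy := mF y Dy.
  have ny : nbhs y [set z | `|y - z| < e] by apply/nbhs_normP; exists e.
  have /Dy[z [Dz [fz yz]]] : nbhs y ([set z | D z -> `|m y - f z| < e]
    `&` [set z | `|y - z| < e]) by exact: filterI.
  by exists z; split => //; exact: fz.
exists m => //; apply: (lipschitz_within _ _ _ m C C0) => y z Dy Dz.
apply: (ler_eps _ _ (2 + 2 * C)) => e e0.
have [y' [Dy' yy' my]] := approx y e Dy e0; have [z' [Dz' zz' mz]] := approx z e Dz e0.
rewrite (_ : m y - m z = (m y - f y') + (f y' - f z') + (f z' - m z)); last first.
  by rewrite !addrA !subrK.
have h1 : `|y' - z'| <= 2 * e + `|y - z|.
  rewrite (_ : y' - z' = (y' - y) + (y - z) + (z - z')); last by rewrite !addrA !subrK.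
  rewrite (le_trans (ler_normD _ _))//.
  rewrite (le_trans (lerD (ler_normD _ _) (lexx _)))//.
  rewrite (distrC y' y); lra.
have h2 := le_trans (fC _ _ Dy' Dz') (ler_wpM2l C0 h1).
rewrite (le_trans (ler_normD _ _))//.
rewrite (le_trans (lerD (ler_normD _ _) (lexx _)))//.
rewrite (distrC (f z')); lra.
Qed.

End approximation.

Arguments closure_approx {R V D y e}.
Arguments within_closure_approx {R V W D f y e}.
Arguments ler_eps {R x y} N.
Arguments norm0_eps {R V v} N.
Arguments lipschitz_within {R V W D f C}.
Arguments lipschitz_extension {R V W D f C}.

(** * Covariance operators *)

Section covariance.
Variables (R : realType) (X : normedModType R).

Lemma second_moment {P : probability (borel X) R} {mu K} (f g : dual X) :
  is_covariance P mu K ->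
  P.-integrable setT (fun x : borel X => (f x * g x)%:E) /\
  (\int[P]_x (f x * g x)%:E = (g (K f) + f mu * g mu)%:E)%E.
Proof.
move=> PK; have [v /(_ g) [ig Ig] Kf] := PK f.
have E : (fun x : X => (g (f x *: x))%:E) = (fun x => (f x * g x)%:E).
  by apply/funext => x; rewrite linearZ.
rewrite Kf linearB linearZ /= subrK -Ig; split; first by rewrite -E.
by apply: eq_integral => x _; rewrite linearZ.
Qed.

Variables (P : probability (borel X) R) (K : dual X -> X).
Hypothesis PK : is_covariance P 0 K.

Lemma covariance_integral (f g : dual X) :
  P.-integrable setT (fun x : borel X => (f x * g x)%:E) /\
  (\int[P]_x (f x * g x)%:E = (g (K f))%:E)%E.
Proof.
by have := second_moment f g PK; rewrite (linear0 f) mul0r addr0.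
Qed.

Lemma covariance_sym (f g : dual X) : f (K g) = g (K f).
Proof.
have [_ fg] := covariance_integral f g; have [_ gf] := covariance_integral g f.
apply: EFin_inj; rewrite -fg -gf; by apply: eq_integral => x _; rewrite mulrC.
Qed.

(** Linearity of K follows from the symmetry of C (f, g) = g (K f) and the
    separation of points. *)
Lemma covariance_linear a (f g h : dual X) :
  (forall x, h x = a * f x + g x) -> K h = a *: K f + K g.
Proof.
move=> hE; apply: dual_separates => l.
by rewrite covariance_sym hE linearP /= (covariance_sym l f) (covariance_sym l g).
Qed.

Lemma covariance_ge0 (f : dual X) : 0 <= f (K f).
Proof.
have [_ ff] := covariance_integral f f.
by rewrite -lee_fin -ff; apply: integral_ge0 => x _; rewrite lee_fin -expr2 sqr_ge0.
Qed.

(** The degenerate case of Cauchy-Schwarz: if f has variance zero then it is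
    uncorrelated with every g. *)
Lemma covariance_null (f : dual X) : f (K f) = 0 -> K f = 0.
Proof.
move=> f0; apply: dual_separates => g; rewrite linear0.
apply/eqP/negPn/negP => c0.
(* Chosen so that g + t f would have variance - 1. *)
pose t := - (g (K g) + 1) / (2 * g (K f)).
have [h hE] := dual_comb t f g.
have := covariance_ge0 h.
rewrite (covariance_linear _ _ _ _ hE) hE !linearD !linearZ /= f0 (covariance_sym f g).
rewrite /GRing.scale /= mulr0 add0r addrA -mulrDr -mulr2n -[_ *+ 2]mulr_natl /t mulfVK ?mulf_neq0//.
lra.
Qed.

End covariance.

Arguments second_moment {R X P mu K} f g.
Arguments covariance_integral {R X P K} PK f g.
Arguments covariance_sym {R X P K} PK f g.
Arguments covariance_linear {R X P K} PK {a f g h}.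
Arguments covariance_null {R X P K} PK f.
Arguments covariance_ge0 {R X P K} PK f.

(** * The inverse of eta and its extension to the closure *)

Section inverse.
Variables (R : realType) (X Y : completeNormedModType R).
Variables (eta : {linear X -> Y}) (eta_cont : continuous eta).
Variables (P : probability (borel X) R) (K : dual X -> X).
Hypothesis PK : is_covariance P 0 K.

Local Notation Keta e := (K (adjoint eta_cont e)).
Local Notation range_K := (Keta_range eta_cont K).
Local Notation D := (eta @` range_K).

Lemma Keta_linear a (e f g : dual Y) : (forall y, g y = a * e y + f y) ->
  Keta g = a *: Keta e + Keta f.
Proof. by move=> gE; apply: (covariance_linear PK) => x; exact: gE. Qed.

Lemma Keta_range_linear a u v : range_K u -> range_K v -> range_K (a *: u + v).
Proof.
move=> [e _ <-] [f _ <-]; have [g gE] := dual_comb a e f.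
by exists g => //; exact: Keta_linear.
Qed.

Lemma Keta_range0 : range_K 0.
Proof.
have [z zE] := dual_comb 0 (Dual (@cst_continuous Y R^o 0 : continuous (\0 : {linear Y -> R^o}))) 
  (Dual (@cst_continuous Y R^o 0 : continuous (\0 : {linear Y -> R^o}))).
exists z => //; apply: (covariance_null PK).
by rewrite /= zE /= mulr0 addr0.
Qed.

Variable M : R.
Hypothesis ME : ratio_sup eta_cont K = M%:E.

Lemma ratio_bound_ge0 : 0 <= M.
Proof. by rewrite -lee_fin -ME; apply: ereal_sup_ubound; left. Qed.

(** The quotients defining the supremum only concern e with
    e (eta (K (eta^* e))) nonzero; for the others K (eta^* e) vanishes. *)
Lemma ratio_bound u : range_K u -> `|u| <= M * `|eta u|.
Proof.
move=> [e _ <-].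
have [e0|e0] := eqVneq (e (eta (Keta e))) 0.
  by rewrite (covariance_null PK (adjoint eta_cont e) e0) linear0 !normr0 mulr0.
have n0 : 0 < `|eta (Keta e)|.
  by rewrite normr_gt0; apply: contra_neq e0 => ->; rewrite linear0.
rewrite -ler_pdivrMr// -lee_fin -ME; apply: ereal_sup_ubound; right.
by exists e.
Qed.

Lemma eta_injective : {in range_K &, injective eta}.
Proof.
move=> u v; rewrite !inE => Du Dv uv.
have := ratio_bound _ (Keta_range_linear (-1) _ _ Dv Du).
rewrite linearP /= uv !scaleN1r addNr normr0 mulr0 normr_le0 addrC.
by rewrite subr_eq0 => /eqP.
Qed.

Lemma eta_invK u : range_K u -> eta_inv eta_cont K (eta u) = u.
Proof. by move=> Du; apply: (pinvKV _ eta_injective); rewrite inE. Qed.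

Lemma eta_inv_lipschitz y z : D y -> D z ->
  `|eta_inv eta_cont K y - eta_inv eta_cont K z| <= M * `|y - z|.
Proof.
move=> [u Du <-] [v Dv <-]; rewrite !eta_invK//.
have := ratio_bound _ (Keta_range_linear (-1) _ _ Dv Du).
by rewrite !scaleN1r addrC linearB.
Qed.

(** Normalizing eta (K (eta^* e)) turns each quotient into a value of the norm
    of the inverse on the unit sphere of its domain. *)
Lemma opnorm_eta_inv : opnorm_on D (eta_inv eta_cont K) = ratio_sup eta_cont K.
Proof.
apply/eqP; rewrite eq_le; apply/andP; split.
  rewrite ME; apply: ge_ereal_sup => _ [y [[u Du <-] /= y1] <-].
  rewrite eta_invK// lee_fin (le_trans (ratio_bound _ Du))//.
  by rewrite -[leRHS]mulr1 ler_wpM2l// ratio_bound_ge0.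
apply: ge_ereal_sup => _ [->|[e /= e0 <-]].
  apply: ereal_sup_ubound; exists 0; last by rewrite -[X in eta_inv _ _ X](linear0 eta) eta_invK ?normr0//; exact: Keta_range0.
  split; last by rewrite /= normr0 ler01.
  by exists 0; [exact: Keta_range0|rewrite linear0].
have n0 : 0 < `|eta (Keta e)|.
  by rewrite normr_gt0; apply: contra_neq e0 => ->; rewrite linear0.
have Du : range_K (`|eta (Keta e)|^-1 *: Keta e).
  by rewrite -[_ *: _]addr0; apply: Keta_range_linear; [exists e|exact: Keta_range0].
apply: ereal_sup_ubound; exists (eta (`|eta (Keta e)|^-1 *: Keta e)).
  split; first by exists (`|eta (Keta e)|^-1 *: Keta e).
  by rewrite /= linearZ normrZ normfV normr_id mulVf ?gt_eqF.
by rewrite eta_invK// normrZ normfV normr_id mulrC.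
Qed.

Lemma eta_inv_extension_exists : exists m, eta_inv_extension eta_cont K m.
Proof.
have [m mc mE] := lipschitz_extension ratio_bound_ge0 eta_inv_lipschitz.
by exists m; split => // y; rewrite inE => /mE.
Qed.

Lemma eta_inv_continuous : {within D, continuous (eta_inv eta_cont K)}.
Proof. exact: lipschitz_within ratio_bound_ge0 eta_inv_lipschitz. Qed.

Section extension.
Variables (m : Y -> X) (mext : eta_inv_extension eta_cont K m).
Local Notation Y0 := (closure D).

Lemma eta_lipschitz : exists2 N, 0 <= N & forall x, `|eta x| <= N * `|x|.
Proof.
have fb := @continuous_linear_bounded R X Y 0 eta (eta_cont 0).
have [N [_ NP]] := proj1 (linear_boundedP eta) fb.
exists (`|N| + 1); first by rewrite addr_ge0.
by apply: NP; rewrite (le_lt_trans (ler_norm _))// ltrDl.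
Qed.

Lemma D_linear a y z : D y -> D z -> D (a *: y + z).
Proof.
move=> [u Du <-] [v Dv <-]; exists (a *: u + v); last by rewrite linearP.
exact: Keta_range_linear.
Qed.

Lemma Y0_0 : Y0 0.
Proof. by apply: subset_closure; exists 0; [exact: Keta_range0|rewrite linear0]. Qed.

Lemma Y0_linear a y z : Y0 y -> Y0 z -> Y0 (a *: y + z).
Proof.
move=> Yy Yz B /nbhs_normP[e /= e0 eB].
have a1 : 0 < `|a| + 1 by rewrite ltr_wpDl.
have e1 : 0 < e / (`|a| + 1) / 2 by rewrite !divr_gt0.
have [y' Dy yy] := closure_approx Yy e1.
have e2 : 0 < e / 2 by rewrite !divr_gt0.
have [z' Dz zz] := closure_approx Yz e2.
exists (a *: y' + z'); split; first exact: D_linear.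
apply: eB => /=.
rewrite (_ : a *: y + z - _ = a *: (y - y') + (z - z')); last first.
  by rewrite scalerBr opprD addrACA.
rewrite (le_lt_trans (ler_normD _ _))// normrZ (splitr e) ler_ltD//.
rewrite (@le_trans _ _ ((`|a| + 1) * `|y - y'|))//; first by rewrite ler_wpM2r// lerDl.
rewrite mulrC -ler_pdivlMr// mulrAC; exact: ltW.
Qed.

Lemma ext_D u : range_K u -> m (eta u) = u.
Proof.
by move=> Du; case: mext => _ ->; [exact: eta_invK|rewrite inE; exists u].
Qed.

(** Any continuous extension inherits the Lipschitz constant, so everything below
    holds for an arbitrary m and not only for the extension constructed
    above. *)
Lemma ext_lipschitz y z : Y0 y -> Y0 z -> `|m y - m z| <= M * `|y - z|.
Proof.
move=> Yy Yz; case: mext => mc mE.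
apply: (ler_eps (2 + 2 * M)) => e e0.
have [y' [Dy' yy' my]] := within_closure_approx mc Yy e0.
have [z' [Dz' zz' mz]] := within_closure_approx mc Yz e0.
rewrite (_ : m y - m z = (m y - m y') + (m y' - m z') + (m z' - m z)); last first.
  by rewrite !addrA !subrK.
have h1 : `|y' - z'| <= 2 * e + `|y - z|.
  rewrite (_ : y' - z' = (y' - y) + (y - z) + (z - z')); last by rewrite !addrA !subrK.
  rewrite (le_trans (ler_normD _ _))//.
  rewrite (le_trans (lerD (ler_normD _ _) (lexx _)))//.
  rewrite (distrC y' y); lra.
have h2 := le_trans (eta_inv_lipschitz _ _ Dy' Dz') (ler_wpM2l ratio_bound_ge0 h1).
rewrite -!mE ?inE// in h2.
rewrite (le_trans (ler_normD _ _))//.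
rewrite (le_trans (lerD (ler_normD _ _) (lexx _)))//.
rewrite (distrC (m z')); lra.
Qed.

Lemma ext_linear a y z : Y0 y -> Y0 z -> m (a *: y + z) = a *: m y + m z.
Proof.
move=> Yy Yz; apply/eqP; rewrite -subr_eq0; apply/eqP.
apply: (norm0_eps (M * (`|a| + 1) + (`|a| + 1) * M)) => e e0.
have [y' Dy' yy'] := closure_approx Yy e0.
have [z' Dz' zz'] := closure_approx Yz e0.
have mD : m (a *: y' + z') = a *: m y' + m z'.
  move: Dy' Dz' => [u Du <-] [v Dv <-].
  by rewrite -linearP !ext_D//; exact: Keta_range_linear.
rewrite (_ : _ - _ = (m (a *: y + z) - m (a *: y' + z')) +
  (a *: (m y' - m y) + (m z' - m z))); last first.
  by rewrite mD scalerBr [X in _ = _ + X]addrACA -opprD addrA subrK.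
have Yy' := subset_closure Dy'; have Yz' := subset_closure Dz'.
have h1 := ext_lipschitz _ _ (Y0_linear a _ _ Yy Yz) (Y0_linear a _ _ Yy' Yz').
have h2 : `|a *: y + z - (a *: y' + z')| <= (`|a| + 1) * e.
  rewrite (_ : _ - _ = a *: (y - y') + (z - z')); last by rewrite scalerBr opprD addrACA.
  by rewrite (le_trans (ler_normD _ _))// normrZ mulrDl mul1r lerD// ?ler_wpM2l// ltW.
have h3 := le_trans h1 (ler_wpM2l ratio_bound_ge0 h2).
have h4 : `|m y' - m y| <= M * e.
  by rewrite (le_trans (ext_lipschitz _ _ Yy' Yy))// ler_wpM2l ?ratio_bound_ge0// distrC ltW.
have h5 : `|m z' - m z| <= M * e.
  by rewrite (le_trans (ext_lipschitz _ _ Yz' Yz))// ler_wpM2l ?ratio_bound_ge0// distrC ltW.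
rewrite (le_trans (ler_normD _ _))// mulrDl lerD//; first by rewrite -mulrA.
rewrite (le_trans (ler_normD _ _))// normrZ -mulrA mulrDl mul1r lerD//.
by rewrite ler_wpM2l.
Qed.

Lemma ext_bound y : Y0 y -> `|m y| <= M * `|y|.
Proof.
move=> Yy; have m0 : m 0 = 0 by rewrite -(linear0 eta) ext_D//; exact: Keta_range0.
by have := ext_lipschitz _ _ Yy Y0_0; rewrite m0 !subr0.
Qed.

Lemma ext_section y : Y0 y -> eta (m y) = y.
Proof.
move=> Yy; apply/eqP; rewrite -subr_eq0; apply/eqP.
have [N N0 NP] := eta_lipschitz.
apply: (norm0_eps (N * M + 1)) => e e0.
have [z Dz yz] := closure_approx Yy e0.
have mz : eta (m z) = z by case: Dz => u Du <-; rewrite ext_D.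
rewrite (_ : _ - _ = eta (m y - m z) + (z - y)); last by rewrite linearB /= mz addrA subrK.
rewrite (le_trans (ler_normD _ _))// mulrDl mul1r lerD//; last by rewrite distrC ltW.
rewrite (le_trans (NP _))// -mulrA ler_wpM2l//.
rewrite (le_trans (ext_lipschitz _ _ Yy (subset_closure Dz)))// ler_wpM2l ?ratio_bound_ge0//.
exact: ltW.
Qed.

(** The functional m^* f on Y0, extended to Y by Hahn-Banach. *)
Lemma ext_dual (f : dual X) : exists e : dual Y, forall y, Y0 y -> e y = f (m y).
Proof.
have [C C0 fC] := dual_bounded f.
apply: (dual_extension Y0 (fun y => f (m y)) (C * M)).
- by rewrite mulr_ge0// ratio_bound_ge0.
- exact: Y0_0.
- exact: Y0_linear.
- by move=> a u v Yu Yv; rewrite ext_linear// linearP.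
- by move=> u Yu; rewrite (le_trans (fC _))// -mulrA ler_wpM2l// ext_bound.
Qed.

(** The difference g of two extensions vanishes at eta (K (eta^* g)), which lies
    in Y0; so it has variance zero. *)
Lemma Keta_ext (e e' : dual Y) : (forall y, Y0 y -> e y = e' y) -> Keta e = Keta e'.
Proof.
move=> ee; have [g gE] := dual_comb (-1) e' e.
have : Keta g = 0.
  apply: (covariance_null PK); rewrite /= gE ee ?mulN1r ?addNr//.
  by apply: subset_closure; exists (Keta g) => //; exists g.
by rewrite (Keta_linear _ _ _ _ gE) scaleN1r addrC => /eqP; rewrite subr_eq0 => /eqP.
Qed.

End extension.
End inverse.

Arguments ratio_bound_ge0 {R X Y eta eta_cont K M}.
Arguments eta_injective {R X Y eta eta_cont P K} PK {M}.
Arguments eta_inv_continuous {R X Y eta eta_cont P K} PK {M}.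
Arguments opnorm_eta_inv {R X Y eta eta_cont P K} PK {M}.
Arguments eta_inv_extension_exists {R X Y eta eta_cont P K} PK {M}.
Arguments Y0_0 {R X Y eta eta_cont P K}.
Arguments Y0_linear {R X Y eta eta_cont P K}.
Arguments ext_D {R X Y eta eta_cont P K} PK {M} ME {m} mext u.
Arguments ext_lipschitz {R X Y eta eta_cont P K} PK {M} ME {m} mext {y z}.
Arguments ext_bound {R X Y eta eta_cont P K} PK {M} ME {m} mext {y}.
Arguments ext_section {R X Y eta eta_cont P K} PK {M} ME {m} mext {y}.
Arguments ext_dual {R X Y eta} eta_cont {P K} PK {M} ME {m} mext f.
Arguments Keta_ext {R X Y eta eta_cont P K} PK {e e'}.

(** * Uniqueness of Gaussian measures and null functionals *)

Lemma dual_measurable {R : realType} {X : normedModType R} (f : dual X) :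
  measurable_fun setT (f : borel X -> measurableTypeR R).
Proof. apply: continuous_measurable_real; exact: (@dual_continuous _ _ f). Qed.

Section gaussian_uniqueness.
Variables (R : realType) (X : normedModType R).

(** Mean and covariance determine the first two moments of every functional,
    hence all one-dimensional marginals. *)
Lemma gaussian_with_unique (P Q : probability (borel X) R) mu K :
  gaussian_with P mu K -> gaussian_with Q mu K ->
  forall B : set (borel X), measurable B -> P B = Q B.
Proof.
move=> [[rP gP] mP cP] [[rQ gQ] mQ cQ].
apply: tight_unique; [exact: radon_tight|exact: radon_tight|].
move=> f c.
have mcos := measurable_cos_shift R c.
apply: (same_marginals_integral _ f (fun t => cos (t + c)) 1) => //; last first.
  by move=> t; rewrite ler_norml cos_geN1 cos_le1.
move=> g A mA.
have [iP2 IP2] := second_moment g g cP; have [iQ2 IQ2] := second_moment g g cQ.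
have sqrE : (fun x : borel X => (g x * g x)%:E) = (fun x => (g x ^+ 2)%:E).
  by apply/funext => x; rewrite expr2.
have sqrI (S : probability (borel X) R) : (\int[S]_x (g x * g x)%:E = \int[S]_x (g x ^+ 2)%:E)%E.
  by apply: eq_integral => x _; rewrite expr2.
have i2 (S : probability (borel X) R) : S.-integrable setT (fun x : borel X => (g x * g x)%:E) ->
    S.-integrable setT (fun x : borel X => (g x ^+ 2)%:E) by rewrite sqrE.
have mean : (\int[P]_x (g x)%:E = \int[Q]_x (g x)%:E)%E by rewrite -mP -mQ.
have mom : (\int[P]_x (g x ^+ 2)%:E = \int[Q]_x (g x ^+ 2)%:E)%E by rewrite -!sqrI IP2 IQ2.
exact: (gauss_law_unique (dual_measurable g) (gP g) (gQ g) (i2 P iP2) (i2 Q iQ2) mean mom).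
Qed.

Lemma null_functional (P : probability (borel X) R) K (f : dual X) :
  is_covariance P 0 K -> f (K f) = 0 -> P [set x : borel X | f x != 0] = 0%E.
Proof.
move=> PK f0; have [iff Iff] := covariance_integral PK f f.
have I0 : (\int[P]_x `|(f x * f x)%:E| = 0)%E.
  rewrite -[RHS]/(0%R%:E) -f0 -Iff; apply: eq_integral => x _.
  by rewrite gee0_abs// lee_fin -expr2 sqr_ge0.
have mff := measurable_int _ iff.
have [N [mN N0 sN]] := proj1 (ae_eq_integral_abs P measurableT mff) I0.
have mS : measurable ([set x | f x != 0] : set (borel X)).
  rewrite (_ : [set _ | _] = (f : borel X -> measurableTypeR R) @^-1` (~` [set 0])).
    by rewrite -[X in measurable X]setTI; apply: dual_measurable => //; exact: measurableC.
  by apply/seteqP; split => x /eqP.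
apply/eqP; rewrite eq_le measure_ge0 andbT -N0; apply: le_measure; rewrite ?inE//.
move=> x /= fx; apply: sN => /= h; have := h I => -[] /eqP.
by rewrite mulf_eq0 orbb (negbTE fx).
Qed.

End gaussian_uniqueness.

Section measurable_family.

(** The sets B for which s |-> k s B is measurable form a lambda-system. *)
Lemma measurable_family (T : ptopologicalType) d (S : measurableType d) (R : realType)
    (k : S -> probability (borel T) R) :
  (forall U : set T, open U -> measurable_fun setT (fun s => k s U)) ->
  forall B : set (borel T), measurable B -> measurable_fun setT (fun s => k s B).
Proof.
move=> kU B mB.
pose H : set (set (borel T)) := [set A | measurable A /\ measurable_fun setT (fun s => k s A)].
suff : <<s setT, @open T >> `<=` H by move=> /(_ B mB)[].
apply: lambda_system_subset => //.
- by move=> U V oU oV; exact: openI.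
- split.
  + by [].
  + split; first exact: measurableT.
    by under eq_fun do rewrite probability_setT; exact: measurable_cst.
  + move=> A A' A'A [mA kA] [mA' kA']; split; first exact: measurableD.
    have E : (fun s => k s (A `\` A')) = (fun s => k s A - k s A')%E.
      apply/funext => s; rewrite measureD ?setIidr//.
      by rewrite -ge0_fin_numE ?measure_ge0// fin_num_measure.
    by rewrite E; exact: emeasurable_funB.
  + move=> F ndF HF; split.
      by apply: bigcup_measurable => n _; case: (HF n).
    apply: (emeasurable_fun_cvg (fun n s => k s (F n))) => [n|s _]; first by case: (HF n).
    apply: nondecreasing_cvg_mu => //; first by move=> n; case: (HF n).
    by apply: bigcup_measurable => n _; case: (HF n).
- by move=> U oU; split; [exact: open_borel|exact: kU].
Qed.

End measurable_family.

(** * The conditional measures and the disintegration *)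

Section conditional.
Variables (R : realType) (X Y : completeNormedModType R).
Variables (eta : {linear X -> Y}) (eta_cont : continuous eta).
Variables (P : probability (borel X) R) (K : dual X -> X).
Hypothesis Pg : gaussian_with P 0 K.
Variable M : R.
Hypothesis ME : ratio_sup eta_cont K = M%:E.
Variables (m : Y -> X) (mext : eta_inv_extension eta_cont K m).

Local Notation Keta e := (K (adjoint eta_cont e)).
Local Notation D := (eta @` Keta_range eta_cont K).
Local Notation Y0 := (closure D).
Local Notation E0 := (eta @^-1` Y0).

Let PK : is_covariance P 0 K. Proof. by case: Pg. Qed.

Let Y0_zero : Y0 0. Proof. exact: Y0_0 PK. Qed.

Lemma E0_closed : closed E0.
Proof. by apply: closed_comp; [move=> x _; exact: eta_cont|exact: closed_closure]. Qed.

Lemma E0_measurable : measurable (E0 : set (borel X)).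
Proof. apply: closed_borel; exact: E0_closed. Qed.

(** A point x with eta x outside Y0 lies in the open set where some functional
    e \o eta does not vanish, with e = 0 on Y0.  Such a functional has variance
    zero, so this open set is null; finitely many of them cover a compact set.
    Passing from compact sets to the whole complement uses that P is Radon, as
    the union of all these null sets is uncountable. *)
Lemma prob_support : P (~` E0) = 0%E.
Proof.
have [[rP _] _ _] := Pg.
rewrite (rP (~` E0) (measurableC E0_measurable)).
apply/eqP; rewrite eq_le; apply/andP; split; last first.
  by apply: ereal_sup_ubound; exists set0; [split; [exact: compact0|]|rewrite measure0].
apply: ge_ereal_sup => _ [C [cC CE] <-].
pose N (U : set X) := measurable (U : set (borel X)) /\ P U = 0%E.
have [|||A CA [mA PA]] := @compact_ind X C N cC.
- by split; [exact: measurable0|rewrite measure0].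
- move=> A B [mA A0] [mB B0]; split; first exact: measurableU.
  by apply/eqP; rewrite eq_le measure_ge0 andbT -[leRHS]adde0 -{1}A0 -B0 measureU2.
- move=> x Cx.
  have Yx : ~ Y0 (eta x) by exact: CE.
  have [e eY ex] := dual_separates_closed Y0 (eta x) Y0_zero
     (Y0_linear PK) (@closed_closure _ _) Yx.
  exists [set z | adjoint eta_cont e z != 0]; split => //.
    have /continuousP ec := @dual_continuous _ _ (adjoint eta_cont e).
    rewrite (_ : [set _ | _] = adjoint eta_cont e @^-1` (~` [set 0])).
      apply: ec; apply: closed_openC; apply: accessible_closed_set1.
      by apply: hausdorff_accessible; exact: Rhausdorff.
    by apply/seteqP; split => z /eqP.
  split; last first.
    apply: (null_functional _ _ _ K) => //=; apply: eY; apply: subset_closure.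
    by exists (Keta e) => //; exists e.
  rewrite (_ : [set _ | _] = (adjoint eta_cont e : borel X -> measurableTypeR R) @^-1` (~` [set 0])).
    by rewrite -[X in measurable X]setTI; apply: dual_measurable => //; exact: measurableC.
  by apply/seteqP; split => z /eqP.
rewrite -PA; apply: le_measure; rewrite ?inE//; exact: compact_borel.
Qed.

Lemma prob_E0 : P E0 = 1%E.
Proof.
have mE := measurableC E0_measurable.
by rewrite -(setCK E0) (probability_setC P mE) prob_support sube0.
Qed.

Lemma prob_setI_E0 (B : set (borel X)) : measurable B -> P B = P (B `&` E0).
Proof.
move=> mB; have mE := E0_measurable.
have mBC : measurable (B `&` ~` E0 : set (borel X)).
  by apply: measurableI => //; exact: measurableC.
have Z : P (B `&` ~` E0) = 0%E.
  apply/eqP; rewrite eq_le measure_ge0 andbT -prob_support.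
  by apply: le_measure; rewrite ?inE//; exact: measurableC.
transitivity (P (B `&` E0) + P (B `&` ~` E0))%E; last by rewrite Z adde0.
rewrite -{1}(setIT B) -(setUv E0) setIUr; apply: measureU => //.
- exact: measurableI.
- by rewrite setIACA setICr setI0.
Qed.

(** Outside the full-measure set E0, where m (eta x) is meaningless, the value 0
    keeps the map Borel. *)
Definition residual (x : X) : X := if `[< Y0 (eta x) >] then x - m (eta x) else 0.

Lemma residualE x : E0 x -> residual x = x - m (eta x).
Proof. by move=> Ex; rewrite /residual asboolT. Qed.

Definition fiber_map (y : Y) (x : X) : X := residual x + m y.

Lemma fiber_map_within y : {within E0, continuous (fiber_map y)}.
Proof.
apply/subspace_continuousP => x Ex.
have mc : {within Y0, continuous m} by case: mext.
have me : (m \o eta) z @[z --> within E0 (nbhs x)] --> m (eta x).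
  have /subspace_continuousP/(_ _ Ex) h := mc.
  apply: (cvg_comp eta m _ h).
  move=> A /= A1; have := eta_cont x _ A1; rewrite /= !nbhs_simpl /=.
  by apply: filterS => z Az Ez; exact: Az.
rewrite /from_subspace.
have -> : fiber_map y x = x - m (eta x) + m y by rewrite /fiber_map residualE.
have c : (z - (m \o eta) z + m y) @[z --> within E0 (nbhs x)] --> x - m (eta x) + m y.
  apply: cvgD; last exact: cvg_cst.
  by apply: cvgB => //; apply: cvg_within.
apply: cvg_trans c; apply: near_eq_cvg; rewrite near_withinE.
by apply: filterE => z Ez; rewrite /fiber_map residualE.
Qed.

Lemma fiber_map_measurable y : measurable_fun setT (fiber_map y : borel X -> borel X).
Proof.
have mE := E0_measurable.
rewrite -(setUv (E0 : set (borel X))); apply/measurable_funU => //; first exact: measurableC.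
split; first by apply: within_continuous_borel => //; exact: fiber_map_within.
apply: (@eq_measurable_fun _ _ (borel X) (borel X) _ (cst (m y))); last exact: measurable_cst.
by move=> x; rewrite inE => Ex; rewrite /fiber_map /residual asboolF// add0r.
Qed.

Definition cond_prob (y : Y) : probability (borel X) R := image_prob (fiber_map_measurable y) P.

Lemma cond_probE y (A : set (borel X)) : cond_prob y A = P (fiber_map y @^-1` A).
Proof. by []. Qed.

Lemma fiber_preimage y (A : set (borel X)) : measurable A ->
  measurable (fiber_map y @^-1` A : set (borel X)).
Proof. by move=> mA; rewrite -[X in measurable X]setTI; exact: fiber_map_measurable. Qed.

(** The image under [fiber_map y] of a compact subset of E0 is compact, since
    that map is continuous on E0. *)
Lemma cond_prob_radon y : radon (cond_prob y).
Proof.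
have [[rP _] _ _] := Pg.
move=> B mB; apply/eqP; rewrite eq_le; apply/andP; split; last first.
  apply: ge_ereal_sup => _ [C [cC CB] <-].
  by apply: le_measure; rewrite ?inE//; exact: compact_borel.
have mA := fiber_preimage y B mB.
rewrite cond_probE prob_setI_E0// rP; last by apply: measurableI => //; exact: E0_measurable.
apply: ge_ereal_sup => _ [C [cC CA] <-].
have cTC : compact (fiber_map y @` C).
  apply: continuous_compact => //.
  apply: continuous_subspaceW (fiber_map_within y).
  by move=> x /CA[].
apply: (@le_trans _ _ (cond_prob y (fiber_map y @` C))).
  rewrite cond_probE; apply: le_measure; rewrite ?inE//.
  - exact: compact_borel.
  - by apply: fiber_preimage; exact: compact_borel.
  - by move=> x Cx; exists x.
apply: ereal_sup_ubound; exists (fiber_map y @` C) => //; split => //.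
by move=> _ [x Cx <-]; have [] := CA x Cx.
Qed.

(** To integrate w against the conditional measure it suffices to know its values
    along the fibre map on E0; outside, the fibre map is constant, which gives
    integrability. *)
Lemma cond_integral y (w v : X -> R) :
  measurable_fun setT (w : borel X -> measurableTypeR R) ->
  P.-integrable setT (fun x : borel X => (v x)%:E) ->
  (forall x, E0 x -> w (fiber_map y x) = v x) ->
  (cond_prob y).-integrable setT (fun x : borel X => (w x)%:E) /\
  (\int[cond_prob y]_x (w x)%:E = \int[P]_x (v x)%:E)%E.
Proof.
move=> mw iv wv.
have mT := fiber_map_measurable y.
have mwT : measurable_fun setT (w \o fiber_map y : borel X -> measurableTypeR R).
  by apply: (@measurableT_comp _ _ _ (borel X) (borel X) (measurableTypeR R) w setT (fiber_map y)); [exact: mw|exact: mT].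
have mwe : measurable_fun setT (fun x : borel X => (w x)%:E) by exact/measurable_EFinP.
have iwT : P.-integrable setT (fun x : borel X => (w (fiber_map y x))%:E).
  apply: (@le_integrable _ _ _ P _ measurableT _
    (fun x : borel X => (`|v x| + `|w (m y)|)%:E)).
  - exact/measurable_EFinP.
  - move=> x _; rewrite !abse_EFin lee_fin [leRHS]ger0_norm ?addr_ge0//.
    have [Ex|Ex] := pselect (E0 x); first by rewrite wv// lerDl.
    by rewrite /fiber_map /residual asboolF// add0r lerDr.
  - under eq_fun do rewrite EFinD.
    apply: integrableD => //; last exact: finite_measure_integrable_cst.
    exact: (integrable_norm iv).
split; first exact: (integrable_pushforward mT mwe iwT measurableT).
transitivity (\int[P]_x (w (fiber_map y x))%:E)%E.
  exact: (integral_pushforward mT mwe iwT measurableT).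
apply: ae_eq_integral => //.
- exact: (measurable_int _ iwT).
- exact: (measurable_int _ iv).
exists (~` E0); split; [exact: measurableC E0_measurable|exact: prob_support|].
by move=> x /= h Ex; apply: h => _; rewrite wv.
Qed.

Definition extends (f : dual X) (e : dual Y) := forall y, Y0 y -> e y = f (m y).

(** On E0 the functional f of the random point is the continuous functional
    g = f - eta^* e plus a constant; this is what makes its law Gaussian. *)
Lemma fiber_map_dual (f : dual X) (e : dual Y) (g : dual X) y x :
  extends f e -> (forall x, g x = -1 * adjoint eta_cont e x + f x) -> E0 x ->
  f (fiber_map y x) = g x + f (m y).
Proof.
move=> fe gE Ex; rewrite /fiber_map residualE// gE linearD linearB /= fe//.
by congr (_ + _); ring.
Qed.

(** The covariance of g = f - eta^* e with e' \o eta is f u - e (eta u) for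
    u = K (eta^* e'), and e (eta u) = f (m (eta u)) = f u. *)
Lemma residual_uncorrelated (f : dual X) (e e' : dual Y) (g : dual X) :
  extends f e -> (forall x, g x = -1 * adjoint eta_cont e x + f x) ->
  adjoint eta_cont e' (K g) = 0.
Proof.
move=> fe gE; rewrite (covariance_sym PK) gE.
have Du : Keta_range eta_cont K (Keta e') by exists e'.
have /= -> := fe (eta (Keta e')) (subset_closure (ex_intro2 _ _ _ Du erefl)).
by rewrite (ext_D PK ME mext)// mulN1r addNr.
Qed.

Lemma residual_covariance (f f' : dual X) (e e' : dual Y) (g g' : dual X) :
  extends f e -> (forall x, g x = -1 * adjoint eta_cont e x + f x) ->
  extends f' e' -> (forall x, g' x = -1 * adjoint eta_cont e' x + f' x) ->
  (\int[P]_x (g x * g' x)%:E = (f' (K f - Keta e))%:E)%E.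
Proof.
move=> fe gE fe' gE'.
have [_ ->] := covariance_integral PK g g'; congr EFin.
have Kg := covariance_linear PK gE.
have z := residual_uncorrelated f e e' g fe gE.
by rewrite gE' z mulr0 add0r Kg scaleN1r addrC.
Qed.

Definition dual_ext (f : dual X) : dual Y :=
  projT1 (cid (ext_dual eta_cont PK ME mext f)).

Lemma dual_extP f : extends f (dual_ext f).
Proof. by rewrite /dual_ext; case: cid. Qed.

Definition cond_cov (f : dual X) : X := K f - Keta (dual_ext f).

Lemma cond_covE f e : extends f e -> cond_cov f = K f - Keta e.
Proof.
move=> fe; congr (_ - _); apply: (Keta_ext PK) => y Yy.
by rewrite dual_extP// fe.
Qed.

(** All three properties are read off the centred Gaussian functional
    g = f - eta^* e: shifting it by f (m y) gives the law and the mean, and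
    expanding the product of two such shifts leaves K - K eta^* m^* by
    [residual_covariance]. *)
Lemma cond_prob_gaussian y : Y0 y -> gaussian_with (cond_prob y) (m y) cond_cov.
Proof.
move=> Yy; have [[_ Pgauss] Pmean _] := Pg.
pose g f : dual X := sval (dual_comb (-1) (adjoint eta_cont (dual_ext f)) f).
have gE f x : g f x = -1 * adjoint eta_cont (dual_ext f) x + f x.
  by rewrite /g; case: dual_comb.
have ig f : P.-integrable setT (fun x : borel X => (g f x)%:E).
  apply: (sqr_integrable (dual_measurable (g f))).
  have [h _] := covariance_integral PK (g f) (g f).
  by apply: eq_integrable h => // x _; rewrite expr2.
have Eg f : (\int[P]_x (g f x)%:E = 0)%E by rewrite -Pmean linear0.
split.
- split; first exact: cond_prob_radon.
  move=> f; apply/real_gaussianP.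
  have /real_gaussianP[a [s gl]] := Pgauss (g f).
  have [s0 h] := gauss_law_shift (f (m y)) gl.
  exists (a + f (m y)), s; split => // A mA; rewrite -h//.
  have mf := dual_measurable f; have mg := dual_measurable (g f).
  have mA1 : measurable (f @^-1` A : set (borel X)).
    by rewrite -[X in measurable X]setTI; exact: mf.
  have mA2 : measurable ((fun x => x + f (m y) : measurableTypeR R) @^-1` A : set (measurableTypeR R)).
    by rewrite -[X in measurable X]setTI; exact: measurable_funD.
  rewrite /pushforward cond_probE prob_setI_E0; last exact: fiber_preimage.
  rewrite [RHS]prob_setI_E0; last by rewrite -[X in measurable X]setTI; exact: mg.
  congr (P _); apply/seteqP; split => x [/= Ax Ex]; split => //; move: Ax;
    by rewrite /= (fiber_map_dual f _ _ _ _ (dual_extP f) (gE f)).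
- move=> f.
  have [|||_ ->] := cond_integral y f (fun x => g f x + f (m y)).
  + exact: (dual_measurable f).
  + under eq_fun do rewrite EFinD.
    by apply: integrableD => //; exact: finite_measure_integrable_cst.
  + by move=> x Ex; exact: (fiber_map_dual f _ _ _ _ (dual_extP f) (gE f)).
  under eq_integral do rewrite EFinD.
  rewrite integralD//; last exact: finite_measure_integrable_cst.
  by rewrite Eg add0e integral_prob_cst.
- move=> f; exists (cond_cov f + f (m y) *: m y); last by rewrite addrK.
  move=> f'.
  have E1 : (fun x : X => (f' (f x *: x))%:E) = (fun x => (f x * f' x)%:E).
    by apply/funext => x; rewrite linearZ.
  pose v x := g f x * g f' x + (f' (m y) * g f x + (f (m y) * g f' x + f (m y) * f' (m y))).
  have [i12 _] := covariance_integral PK (g f) (g f').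
  have i3 : P.-integrable setT (fun x : borel X => (f (m y) * g f' x)%:E + (f (m y) * f' (m y))%:E)%E.
    apply: integrableD => //; last exact: finite_measure_integrable_cst.
    by under eq_fun do rewrite EFinM; exact: integrableZl.
  have i4 : P.-integrable setT (fun x : borel X => (f' (m y) * g f x)%:E).
    by under eq_fun do rewrite EFinM; exact: integrableZl.
  have vE x : (v x)%:E = ((g f x * g f' x)%:E + ((f' (m y) * g f x)%:E +
     ((f (m y) * g f' x)%:E + (f (m y) * f' (m y))%:E)))%E by rewrite -!EFinD.
  have [|||iw Iw] := cond_integral y (fun x => f x * f' x) v.
  + by apply: measurable_funM; [exact: (dual_measurable f)|exact: (dual_measurable f')].
  + under eq_fun do rewrite vE.
    by apply: integrableD => //; exact: integrableD.
  + move=> x Ex; rewrite /v (fiber_map_dual f _ _ _ _ (dual_extP f) (gE f))//.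
    by rewrite (fiber_map_dual f' _ _ _ _ (dual_extP f') (gE f'))//; ring.
  split; first by rewrite E1.
  transitivity (\int[cond_prob y]_x (f x * f' x)%:E)%E.
    by apply: eq_integral => x _; rewrite linearZ.
  rewrite Iw; under eq_integral do rewrite vE.
  rewrite (integralD measurableT i12 (integrableD measurableT i4 i3)) (integralD measurableT i4 i3).
  rewrite (residual_covariance _ _ _ _ _ _ (dual_extP f) (gE f) (dual_extP f') (gE f')).
  under eq_integral do rewrite EFinM.
  rewrite integralZl// Eg mule0 add0e.
  rewrite integralD//; [|by under eq_fun do rewrite EFinM; exact: integrableZl|exact: finite_measure_integrable_cst].
  under eq_integral do rewrite EFinM.
  rewrite integralZl// Eg mule0 add0e integral_prob_cst.
  by rewrite -EFinD; congr EFin; rewrite [RHS]linearD; congr (_ + _); rewrite [RHS]linearZ.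
Qed.

(** If m z is within 1/(n+1) of m y, then a point sent into [shrink U n] by the
    fibre map at y is sent into U by the one at z. *)
Lemma cond_prob_lsc (U : set X) (a : R) y : open U -> Y0 y -> (a%:E < cond_prob y U)%E ->
  exists2 d : R, 0 < d & forall z, Y0 z -> `|y - z| < d -> (a%:E < cond_prob z U)%E.
Proof.
move=> oU Yy aU.
have mF n : measurable (shrink U n : set (borel X)).
  by apply: closed_borel; exact: shrink_closed.
have cv : cond_prob y (shrink U n) @[n --> \oo] --> cond_prob y U.
  rewrite -[X in _ --> cond_prob y X](bigcup_shrink U oU).
  apply: nondecreasing_cvg_mu => //.
    by rewrite bigcup_shrink//; exact: open_borel.
  exact: shrink_nondecreasing.
have [n an] : exists n, (a%:E < cond_prob y (shrink U n))%E.
  apply: contrapT => /forallNP h; move: aU; rewrite ltNge => /negP; apply.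
  rewrite -(cvg_lim _ cv)//; apply: lime_le; first by apply/cvg_ex; exists (cond_prob y U).
  by apply: nearW => n; rewrite leNgt; apply/negP/h.
have M1 : 0 < M + 1 by rewrite ltr_wpDl// (ratio_bound_ge0 ME).
exists (n.+1%:R^-1 / (M + 1)); first by rewrite divr_gt0.
move=> z Yz yz; apply: (lt_le_trans an); rewrite !cond_probE.
apply: le_measure; rewrite ?inE.
- exact: fiber_preimage.
- by apply: fiber_preimage; exact: open_borel.
- move=> x /= h; apply: h.
  rewrite /fiber_map (_ : _ - _ = m y - m z); last by rewrite opprD addrACA subrr add0r.
  rewrite (le_lt_trans (ext_lipschitz PK ME mext Yy Yz))//.
  rewrite (@le_lt_trans _ _ ((M + 1) * `|y - z|))//; first by rewrite ler_wpM2r// lerDl.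
  by rewrite mulrC -ltr_pdivlMr.
Qed.

Lemma Y0_measurable : measurable (Y0 : set (borel Y)).
Proof. by apply: closed_borel; exact: closed_closure. Qed.

Lemma cond_prob_measurable_open (U : set X) : open U ->
  measurable_fun (Y0 : set (borel Y)) (fun y : borel Y => cond_prob y U).
Proof.
move=> oU; apply: (measurability _ (ErealGenOInfty.measurableE R)).
move=> _ [_ [a ->] <-].
(* The union of the balls on which the inequality is known to persist. *)
pose V : set Y := [set z | exists y d, [/\ Y0 y, 0 < d, `|y - z| < d &
  forall t, Y0 t -> `|y - t| < d -> (a%:E < cond_prob t U)%E]].
have oV : open V.
  rewrite openE => z [y [d [Yy d0 yz h]]].
  apply/nbhs_normP; exists (d - `|y - z|); first by rewrite /= subr_gt0.
  move=> t zt; exists y, d; split => //.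
  rewrite (_ : y - t = (y - z) + (z - t)); last by rewrite addrA subrK.
  by rewrite (le_lt_trans (ler_normD _ _))// -ltrBrDl.
rewrite (_ : _ `&` _ = Y0 `&` V).
  by apply: measurableI; [exact: Y0_measurable|exact: open_borel].
apply/seteqP; split => y [Yy]; rewrite /= in_itv /= andbT.
  move=> /(cond_prob_lsc _ _ _ oU Yy)[d d0 h]; split => //.
  by exists y, d; split => //; rewrite subrr normr0.
by move=> [z [d [Yz d0 zy h]]]; split => //; exact: h.
Qed.

(** A kernel on all of Y; its values off the full-measure set Y0 are
    arbitrary. *)
Definition cond_kernel (y : borel Y) : probability (borel X) R :=
  cond_prob (if `[< Y0 y >] then y else 0).

Lemma cond_kernelE y : Y0 y -> cond_kernel y = cond_prob y.
Proof. by move=> Yy; rewrite /cond_kernel asboolT. Qed.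

Lemma cond_kernel_measurable (B : set (borel X)) : measurable B ->
  measurable_fun setT (fun y => cond_kernel y B).
Proof.
move=> mB; apply: measurable_family => // U oU.
have mY := Y0_measurable.
rewrite -(setUv (Y0 : set (borel Y))); apply/measurable_funU => //; first exact: measurableC.
split.
  apply: (eq_measurable_fun (fun y : borel Y => cond_prob y U)).
    by move=> y; rewrite inE => Yy; rewrite cond_kernelE.
  exact: cond_prob_measurable_open.
apply: (eq_measurable_fun (cst (cond_prob 0 U))); last exact: measurable_cst.
by move=> y; rewrite inE => Yy; rewrite /cond_kernel asboolF.
Qed.

Lemma cond_kernel_giry : measurable_fun setT (cond_kernel : borel Y -> giry (borel X) R).
Proof. by apply: measurable_giry_codensity => // B mB; exact: cond_kernel_measurable. Qed.

Lemma eta_measurable : measurable_fun setT (eta : borel X -> borel Y).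
Proof. exact: continuous_borel. Qed.

Lemma eta_fiber_measurable (y : Y) : measurable (eta @^-1` [set y] : set (borel X)).
Proof.
rewrite -[X in measurable X]setTI; apply: eta_measurable => //.
apply: closed_borel; apply: accessible_closed_set1; apply: hausdorff_accessible.
exact: (@norm_hausdorff _ Y).
Qed.

Definition law_prob : probability (borel Y) R := image_prob eta_measurable P.

Lemma law_prob_Y0C : law_prob (~` Y0) = 0%E.
Proof. exact: prob_support. Qed.

Definition mixture : giry (borel X) R := giry_bind (law_prob : giry (borel Y) R) cond_kernel_giry.

Lemma mixture_integral (h : borel X -> \bar R) : measurable_fun setT h ->
  (forall x, (0 <= h x)%E) ->
  (\int[mixture]_x h x = \int[law_prob]_y \int[cond_kernel y]_x h x)%E.
Proof. by move=> mh h0; exact: giry_int_bind. Qed.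

Lemma mixture_setT : mixture setT = 1%E.
Proof.
rewrite -[LHS]mul1e -integral_cst// mixture_integral//.
under eq_integral do rewrite integral_prob_cst.
by rewrite integral_prob_cst.
Qed.

Definition mixture_prob : probability (borel X) R :=
  HB.pack (mixture : set (borel X) -> \bar R) (Measure.class mixture)
    (Measure_isProbability.Build _ _ _ mixture mixture_setT).

Lemma mixture_probE (B : set (borel X)) : measurable B ->
  mixture_prob B = (\int[law_prob]_y cond_kernel y B)%E.
Proof.
move=> mB; rewrite -[LHS]/(mixture B) -[in LHS](setIT B) -integral_indic//.
have m1 : measurable_fun setT (fun x : borel X => (\1_B x : R)%:E).
  by apply/measurable_EFinP; exact: measurable_indic.
have p1 (x : borel X) : (0 <= (\1_B x : R)%:E)%E by rewrite lee_fin.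
rewrite (mixture_integral _ m1 p1).
by apply: eq_integral => y _; rewrite integral_indic// setIT.
Qed.

(** If C carries P up to e/2, then all measures of the family with index in
    eta C give mass at least P C to the compact set
    residual C + m (eta C), and eta C itself has mass at least P C. *)
Lemma mixture_tight : tight mixture_prob.
Proof.
move=> e e0; have [[rP _] _ _] := Pg.
have e2 : 0 < e / 2 by rewrite divr_gt0.
have [C' cC' PC'] := radon_tight P rP _ e2.
pose C := C' `&` E0.
have cC : compact C.
  apply: (subclosed_compact _ cC'); last exact: subIsetl.
  apply: closedI; last exact: E0_closed.
  by apply: compact_closed => //; exact: norm_hausdorff.
have PC : ((1 - e / 2)%:E <= P C)%E by rewrite -prob_setI_E0//; exact: compact_borel.
have etaC : eta @` C `<=` Y0 by move=> _ [x [_ Ex] <-].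
have cetaC : compact (eta @` C).
  by apply: continuous_compact => //; apply: continuous_subspaceT; exact: eta_cont.
have cB : compact (m @` (eta @` C)).
  by apply: continuous_compact => //; case: mext => + _; exact: continuous_subspaceW.
have cA : compact (fiber_map 0 @` C).
  apply: continuous_compact => //; apply: continuous_subspaceW (fiber_map_within 0).
  by move=> x [].
pose S := (fun p : X * X => p.1 + p.2) @` ((fiber_map 0 @` C) `*` (m @` (eta @` C))).
have cS : compact S.
  apply: continuous_compact; last exact: compact_setX.
  by apply: continuous_subspaceT => p; exact: add_continuous.
exists S => //.
have mS : measurable (S : set (borel X)) by exact: compact_borel.
have mC : measurable (C : set (borel X)) by exact: compact_borel.
have metaC : measurable (eta @` C : set (borel Y)) by exact: compact_borel.
have m0 : m 0 = 0.
  apply/eqP; rewrite -normr_le0.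
  by rewrite (le_trans (ext_bound PK ME mext Y0_zero))// normr0 mulr0.
pose p := fine (P C).
have pE : P C = p%:E by rewrite fineK// fin_num_measure.
have p0 : 0 <= p by rewrite -lee_fin -pE.
have p1 : p <= 1 by rewrite -lee_fin -pE probability_le1.
rewrite mixture_probE//.
apply: (@le_trans _ _ (\int[law_prob]_(y in eta @` C) p%:E)%E).
  rewrite integral_cst//.
  have pp : (p%:E <= law_prob (eta @` C))%E.
    rewrite -pE; apply: le_measure; rewrite ?inE//.
      by rewrite -[X in measurable X]setTI; exact: eta_measurable.
    by move=> x Cx; exists x.
  apply: (@le_trans _ _ (p%:E * p%:E)%E); last by rewrite lee_wpmul2l// lee_fin.
  (* p^2 >= 1 - 2 (1 - p) >= 1 - e. *)
  rewrite -EFinM lee_fin; move: PC; rewrite pE lee_fin => pe; nra.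
apply: (@le_trans _ _ (\int[law_prob]_(y in eta @` C) cond_kernel y S)%E).
  apply: ge0_le_integral => //.
  - by apply: measurable_funTS; exact: cond_kernel_measurable.
  - move=> y [x Cx xy]; have Yy : Y0 y by apply: etaC; exists x.
    rewrite cond_kernelE// -pE cond_probE; apply: le_measure; rewrite ?inE//.
      exact: fiber_preimage.
    move=> z Cz; exists (fiber_map 0 z, m y).
      by split; [exists z|exists y => //; exists x].
    by rewrite /fiber_map /= m0 addr0.
apply: ge0_subset_integral => //.
exact: cond_kernel_measurable.
Qed.

(** With g = f - eta^* e, the integral under the mixture is the double integral
    of u (g x + e (eta x')) over independent x and x', and g and e \o eta are
    uncorrelated with sum f. *)
Lemma mixture_marginal (f : dual X) (u : R -> R) (C : R) :
  measurable_fun setT u -> (forall t, 0 <= u t <= C) ->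
  (\int[mixture_prob]_x (u (f x))%:E = \int[P]_x (u (f x))%:E)%E.
Proof.
move=> mu uC; have [[_ Pgauss] Pmean _] := Pg.
have u0 t : 0 <= u t by case/andP: (uC t).
pose e := dual_ext f; pose ae := adjoint eta_cont e.
have [g gE] := dual_comb (-1) ae f.
have fe := dual_extP f.
have mg := dual_measurable g; have mae := dual_measurable ae.
have muf : measurable_fun setT (fun x : borel X => (u (f x))%:E).
  apply/measurable_EFinP; apply: measurableT_comp; [exact: mu|exact: (dual_measurable f)].
pose G t : \bar R := (\int[P]_x (u (g x + t))%:E)%E.
have mG : measurable_fun setT G.
  apply: (@measurable_fun_fubini_tonelli_F _ _ _ _ R P (fun p : R * borel X => (u (g p.2 + p.1))%:E)).
    apply/measurable_EFinP; apply: measurableT_comp; first exact: mu.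
    by apply: measurable_funD => //; apply: measurableT_comp.
  by move=> p; rewrite lee_fin.
transitivity (\int[law_prob]_y \int[cond_kernel y]_x (u (f x))%:E)%E.
  by apply: mixture_integral => // x; rewrite lee_fin.
pose H y : \bar R := (\int[cond_kernel y]_x (u (f x))%:E)%E.
have mH : measurable_fun setT H.
  apply: (measurableT_comp (measurable_giry_int muf _) cond_kernel_giry).
  by move=> x; rewrite lee_fin.
have H0 y : (0 <= H y)%E by apply: integral_ge0 => x _; rewrite lee_fin.
transitivity (\int[P]_x H (eta x))%E.
  exact: (ge0_integral_pushforward eta_measurable P measurableT mH).
transitivity (\int[P]_x G (ae x))%E.
  apply: ae_eq_integral => //.
  - exact: (measurableT_comp mH eta_measurable).
  - exact: (measurableT_comp mG mae).
  exists (~` E0); split; [exact: measurableC E0_measurable|exact: prob_support|].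
  move=> x /= h Ex; apply: h => _; rewrite /H cond_kernelE//.
  have mfm : measurable_fun setT (fun z : borel X => (u (f (fiber_map (eta x) z)))%:E).
    exact: (measurableT_comp muf (fiber_map_measurable _)).
  transitivity (\int[P]_z (u (f (fiber_map (eta x) z)))%:E)%E.
    apply: (ge0_integral_pushforward (fiber_map_measurable (eta x)) P measurableT muf).
    by move=> z _; rewrite lee_fin.
  apply: ae_eq_integral => //.
    apply/measurable_EFinP; apply: measurableT_comp; first exact: mu.
    by apply: measurable_funD.
  exists (~` E0); split; [exact: measurableC E0_measurable|exact: prob_support|].
  move=> z /= h Ez; apply: h => _; congr (u _)%:E.
  by rewrite (fiber_map_dual f e g _ _ fe gE)// -fe.
have [if2 _] := covariance_integral PK g g; have [ig2 _] := covariance_integral PK ae ae.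
have [ifg Ifg] := covariance_integral PK g ae.
have sq (h : dual X) : P.-integrable setT (fun x : borel X => (h x * h x)%:E) ->
    P.-integrable setT (fun x : borel X => (h x ^+ 2)%:E).
  by apply: eq_integrable => // x _; rewrite expr2.
have fE x : f x = g x + ae x by rewrite gE mulN1r addrAC addNr add0r.
apply: (gauss_convolution mg mae (dual_measurable f)
  (Pgauss g) (Pgauss ae) (Pgauss f) fE (sq _ if2) (sq _ ig2) ifg _ _ _ mu uC).
- by rewrite -Pmean linear0.
- by rewrite -Pmean linear0.
- by rewrite Ifg (residual_uncorrelated f e e g fe gE).
Qed.

(** [mixture_marginal] concerns nonnegative functions, whence the shift of the
    cosine by 1. *)
Lemma mixtureE (B : set (borel X)) : measurable B -> mixture_prob B = P B.
Proof.
have [[rP _] _ _] := Pg.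
apply: (tight_unique mixture_tight (radon_tight P rP)) => f c.
have mcos := measurable_cos_shift R c.
have cb t : `|cos (t + c)| <= 1 by rewrite ler_norml cos_geN1 cos_le1.
(* Written as a linear combination for the integral below. *)
pose u t : R := 1 * cos (t + c) + 1.
have mu : measurable_fun setT u by apply: measurable_funD => //; apply: measurable_funM.
have ub t : 0 <= u t <= 2.
  by rewrite /u mul1r; have := cos_geN1 (t + c); have := cos_le1 (t + c) => h1 h2; apply/andP; split; lra.
have mcf : measurable_fun setT (fun x : borel X => cos (f x + c)).
  exact: (measurableT_comp mcos (dual_measurable f)).
have E (Q : probability (borel X) R) :
    (\int[Q]_x (u (f x))%:E = \int[Q]_x (cos (f x + c))%:E + 1)%E.
  rewrite /u (bounded_integral_lin Q 1 (fun x : borel X => cos (f x + c)) (cst 1) 1 1)//; last first.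
    by move=> x; rewrite /= normr1.
  by rewrite mul1e; congr (_ + _)%E; exact: (integral_prob_cst Q 1%E).
have fin (Q : probability (borel X) R) : (\int[Q]_x (cos (f x + c))%:E)%E \is a fin_num.
  apply: integrable_fin_num => //.
  exact: (bounded_integrable Q (fun x : borel X => cos (f x + c)) 1 mcf (fun x => cb (f x))).
have := mixture_marginal f u 2 mu ub; rewrite !E.
rewrite -(fineK (fin mixture_prob)) -(fineK (fin P)) -!EFinD => -[/addIr ->].
by [].
Qed.

(** For nonnegative functions this is the definition of the mixture; integrable
    functions are split into positive and negative parts. *)
Lemma disintegration_formula (f : borel X -> R) : P.-integrable setT (EFin \o f) ->
  (\int[P]_x (f x)%:E = \int[law_prob]_(y in Y0) \int[cond_prob y]_x (f x)%:E)%E.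
Proof.
move=> intf.
have key (h : borel X -> \bar R) : measurable_fun setT h -> (forall x, (0 <= h x)%E) ->
    (\int[law_prob]_y \int[cond_kernel y]_x h x = \int[P]_x h x)%E.
  move=> mh h0; rewrite -mixture_integral//.
  by apply: eq_measure_integral => A mA _; exact: mixtureE.
pose F : borel X -> \bar R := EFin \o f.
have mF : measurable_fun setT F := measurable_int _ intf.
have mp := measurable_funepos mF; have mn := measurable_funeneg mF.
pose H (h : borel X -> \bar R) y : \bar R := (\int[cond_kernel y]_x h x)%E.
have intH (h : borel X -> \bar R) : (forall x, (0 <= h x)%E) -> P.-integrable setT h ->
    law_prob.-integrable setT (H h).
  move=> h0 ih; have mh := measurable_int _ ih; apply/integrableP; split.
    exact: (measurableT_comp (measurable_giry_int mh h0) cond_kernel_giry).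
  have [_ lth] := integrableP _ _ _ ih.
  have -> : (\int[law_prob]_y `|H h y| = \int[P]_x `|h x|)%E.
    transitivity (\int[law_prob]_y H h y)%E.
      by apply: eq_integral => y _; rewrite gee0_abs// integral_ge0.
    by rewrite /H key//; apply: eq_integral => x _; rewrite gee0_abs.
  exact: lth.
have ip := intH _ (funepos_ge0 F) (integrable_funepos measurableT intf).
have inn := intH _ (funeneg_ge0 F) (integrable_funeneg measurableT intf).
transitivity (\int[law_prob]_y (H F^\+ y - H F^\- y))%E.
  rewrite integralB// /H !key//; first by rewrite -integralE.
transitivity (\int[law_prob]_(y in Y0) (H F^\+ y - H F^\- y))%E.
  rewrite (negligible_integral (measurableC Y0_measurable) measurableT); last 2 first.
  - exact: integrableB.
  - exact: law_prob_Y0C.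
  by rewrite setDE setTI setCK.
apply: eq_integral => y; rewrite inE => Yy.
by rewrite /H cond_kernelE// -integralE.
Qed.

Lemma cond_prob_eta_fiber y : Y0 y -> cond_prob y (eta @^-1` [set y]) = 1%E.
Proof.
move=> Yy; rewrite cond_probE prob_setI_E0; last first.
  by apply: fiber_preimage; exact: eta_fiber_measurable.
rewrite -prob_E0; congr (P _); apply/seteqP; split => [x []//|x Ex]; split => //=.
rewrite /fiber_map residualE// linearD linearB /=.
by rewrite !(ext_section PK ME mext)// subrr add0r.
Qed.

Lemma cond_prob_weak_cvg (y_ : nat -> Y) y : (forall n, Y0 (y_ n)) -> Y0 y ->
  y_ @ \oo --> y -> weak_cvg (fun n => cond_prob (y_ n)) (cond_prob y).
Proof.
move=> Yy_ Yy cy phi phic [C [_ Cphi]].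
have mphi := continuous_measurable_real phi phic.
have bphi x : `|phi x| <= C + 1 by apply: Cphi => //; rewrite ltrDl.
have E z : (\int[cond_prob z]_x (phi x)%:E = \int[P]_x (phi (fiber_map z x))%:E)%E.
  have mT := fiber_map_measurable z.
  apply: (integral_pushforward mT _ _ measurableT); first exact/measurable_EFinP.
  apply: (bounded_integrable P (fun x : borel X => phi (fiber_map z x)) (C + 1)) => //.
  exact: (measurableT_comp mphi mT).
under eq_fun do rewrite E; rewrite E.
apply: (@bounded_cvg_integral _ (borel X) R P (fun n (x : borel X) => phi (fiber_map (y_ n) x)) (fun x => phi (fiber_map y x)) (C + 1)).
- by move=> n; exact: (measurableT_comp mphi (fiber_map_measurable (y_ n))).
- by move=> n x; exact: bphi.
- move=> x; apply: (cvg_comp (fun n => fiber_map (y_ n) x) phi); last exact: phic.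
  apply: cvgD; first exact: cvg_cst.
  have M1 : 0 < M + 1 by rewrite ltr_wpDl// (ratio_bound_ge0 ME).
  apply/cvgrPdist_lt => e e0.
  have /cvgrPdist_lt/(_ (e / (M + 1))) := cy.
  rewrite divr_gt0// => /(_ isT); apply: filterS => n yn.
  rewrite (le_lt_trans (ext_lipschitz PK ME mext Yy (Yy_ n)))//.
  rewrite (@le_lt_trans _ _ ((M + 1) * `|y - y_ n|))//; first by rewrite ler_wpM2r// lerDl.
  by rewrite mulrC -ltr_pdivlMr.
Qed.

Lemma continuous_disintegration_gaussian (Q : Y -> probability (borel X) R) :
  (forall y, Y0 y -> gaussian_with (Q y) (m y) cond_cov) ->
  continuous_disintegration eta P Y0 Q.
Proof.
move=> Qg.
have QE y (B : set (borel X)) : Y0 y -> measurable B -> Q y B = cond_prob y B.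
  move=> Yy; apply: gaussian_with_unique; [exact: Qg|exact: cond_prob_gaussian].
have intE (h : borel X -> \bar R) y : Y0 y ->
    (\int[Q y]_x h x = \int[cond_prob y]_x h x)%E.
  by move=> Yy; apply: eq_measure_integral => B mB _; exact: QE.
split; [exact: closed_closure|exact: prob_E0| |].
- split.
  + move=> B mB; apply: (eq_measurable_fun (fun y : borel Y => cond_prob y B)).
      by move=> y; rewrite inE => Yy; rewrite QE.
    apply: (eq_measurable_fun (fun y : borel Y => cond_kernel y B)).
      by move=> y; rewrite inE => Yy; rewrite cond_kernelE.
    by apply: measurable_funTS; exact: cond_kernel_measurable.
  + exists set0; split; [exact: measurable0|by rewrite /law /pushforward preimage_set0 measure0|].
    move=> y /=; apply; move=> Yy; rewrite QE//; first exact: cond_prob_eta_fiber.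
    exact: eta_fiber_measurable.
  + move=> f intf; rewrite disintegration_formula//.
    by apply: eq_integral => y; rewrite inE => Yy; rewrite intE.
- move=> y_ y Yy_ cy phi phic bphi.
  have Yy : Y0 y.
    by apply: (closed_cvg _ (@closed_closure _ D) _ _ cy) => //; exact: nearW.
  under eq_fun do rewrite (intE _ _ (Yy_ _)).
  by rewrite intE//; exact: cond_prob_weak_cvg.
Qed.

End conditional.

Theorem theorem2 (R : realType) (X Y : completeNormedModType R)
    (eta : {linear X -> Y}) (eta_cont : continuous eta)
    (P : probability (borel X) R) (K : dual X -> X) (M : \bar R) :
  gaussian_with P 0 K ->
  M = ratio_sup eta_cont K ->
  (M < +oo)%E ->
  let D : set Y := eta @` Keta_range eta_cont K in
  let Y0 : set Y := closure D in
  [/\ {in Keta_range eta_cont K &, injective eta},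
      {within D, continuous (eta_inv eta_cont K)},
      opnorm_on D (eta_inv eta_cont K) = M,
      exists m : Y -> X, eta_inv_extension eta_cont K m &
      forall m : Y -> X, eta_inv_extension eta_cont K m ->
        {in Y0, eta \o m =1 id} /\
        exists Khat : dual X -> X,
          [/\ forall f : dual X, exists e : dual Y, {in Y0, e =1 f \o m},
              forall (f : dual X) (e : dual Y), {in Y0, e =1 f \o m} ->
                Khat f = K f - K (adjoint eta_cont e),
              forall y, Y0 y ->
                exists Q : probability (borel X) R, gaussian_with Q (m y) Khat &
              forall Q : Y -> probability (borel X) R,
                (forall y, Y0 y -> gaussian_with (Q y) (m y) Khat) ->
                continuous_disintegration eta P Y0 Q]].
Proof.
move=> Pg ME Mfin D Y0; have [_ _ PK] := Pg.
have ME' : ratio_sup eta_cont K = (fine M)%:E.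
  have M0 : (0 <= ratio_sup eta_cont K)%E by apply: ereal_sup_ubound; left.
  by rewrite -ME fineK// ge0_fin_numE// ME.
split.
- exact: (eta_injective PK ME').
- exact: (eta_inv_continuous PK ME').
- by rewrite ME; exact: (opnorm_eta_inv PK ME').
- exact: (eta_inv_extension_exists PK ME').
move=> m mext; split.
  by move=> y; rewrite inE => Yy; exact: (ext_section PK ME' mext).
exists (cond_cov _ _ _ _ eta_cont _ _ Pg _ ME' _ mext); split.
- move=> f; have [e eE] := ext_dual eta_cont PK ME' mext f.
  by exists e => y; rewrite inE => /eE.
- by move=> f e fe; apply: cond_covE => y Yy; apply: fe; rewrite inE.
- move=> y Yy; exists (cond_prob _ _ _ _ eta_cont P K m mext y).
  exact: cond_prob_gaussian.
- exact: continuous_disintegration_gaussian.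
Qed.
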